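(* Let $\dot A$ be a densely defined closed symmetric operator with deficiency indices $(1,1)$ in a Hilbert space $\mathcal H$, let $\mathcal H_+\subset\mathcal H\subset\mathcal H_-$ be the rigged Hilbert space generated by $\dot A$, let $g_\pm\in\operatorname{Ker}(\dot A^*\mp iI)$ be $(+)$-normalized deficiency vectors, $\|g_\pm\|_+=1$, and set $\varphi=\mathcal R^{-1}g_+$, $\psi=\mathcal R^{-1}g_-$, where $\mathcal R$ is the Riesz-Berezansky operator. Suppose that $A$ is the self-adjoint extension of $\dot A$ such that $g_+-g_-\in\mathrm{Dom}(A)$. Then the Weyl-Titchmarsh function $M_{(\dot A,A)}(z)$ associated with the pair $(\dot A,A)$ coincides with the impedance function of a unique L-system of the form $$\Theta_{10}=\begin{pmatrix}\mathbb A_{10}&K_{10}&1\\ \mathcal H_+\subset\mathcal H\subset\mathcal H_-&&\mathbb C\end{pmatrix},$$ where $$\mathbb A_{10}=\dot A^*-i(\cdot,\psi)(\varphi-\psi),\qquad K_{10}c=c\cdot\chi_{10}\ (c\in\mathbb C),\qquad \chi_{10}=\tfrac1{\sqrt2}(\varphi-\psi).$$ In this case the von Neumann parameter $\kappa$ of the main operator $T_{10}$ of $\Theta_{10}$ and the von Neumann parameter $U$ of the quasi-kernel $\hat A_{10}=A$ of $\mathrm{Re}\,\mathbb A_{10}$ are $$\kappa=0\quad\text{and}\quad U=-1.$$ Moreover, if $\Theta$ is an L-system with state-space operator $\mathbb A$, main operator $T$ and symmetric operator $\dot A$ such that $V_\Theta(z)=M_{(\dot A,A)}(z)$ for $z\in\mathbb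 C_\pm$, where $A=\hat A$ is the quasi-kernel of $\mathrm{Re}\,\mathbb A$, then the von Neumann parameters $\kappa$ of $T$ and $U$ of $\hat A$ are $\kappa=0$ and $U=-1$.
   Context: Inner products are linear in the first argument. $\mathbb C_\pm$ are the open upper and lower half-planes. Rigged space. For a closed densely defined symmetric $\dot A$ in $\mathcal H$, $\mathcal H_+=\mathrm{Dom}(\dot A^* )$ with $(f,g)_+=(f,g)+(\dot A^*f,\dot A^*g)$, and $\mathcal H_-$ is the corresponding negative space (dual of $\mathcal H_+$ with respect to the pairing extending the inner product of $\mathcal H$, also written $(\cdot,\cdot)$), so $\mathcal H_+\subset\mathcal H\subset\mathcal H_-$. The Riesz-Berezansky operator $\mathcal R$ is the isometric (linear) map of $\mathcal H_-$ onto $\mathcal H_+$ with $(f,g)=(f,\mathcal Rg)_+$ for $f\in\mathcal H_+$, $g\in\mathcal H_-$. $[\mathcal H_1,\mathcal H_2]$ denotes bounded linear operators. For $\mathbb A\in[\mathcal H_+,\mathcal H_-]$ the adjoint $\mathbb A^*\in[\mathcal H_+,\mathcal H_-]$ is taken with respect to the pairing; $\mathrm{Re}\,\mathbb A=\frac12(\mathbb A+\mathbb A^* )$, $\mathrm{Im}\,\mathbb A=\frac1{2i}(\mathbb A-\mathbb A^* )$. For $u,v\in\mathcal H_-$, $(\cdot,u)v$ denotes the operator $f\mapsto(f,u)v$ from $\mathcal H_+$ to $\mathcal H_-$. Extensions. A quasi-self-adjoint extension of $\dot A$ is a non-symmetric operator $T$ in $\mathcal H$ with $\dot A\subset T\subset\dot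 A^*$. A self-adjoint bi-extension of $\dot A$ is $\mathbb B\in[\mathcal H_+,\mathcal H_-]$ with $\dot A\subset\mathbb B=\mathbb B^*$; its quasi-kernel is the restriction of $\mathbb B$ to $\{f\in\mathcal H_+:\mathbb Bf\in\mathcal H\}$; it is t-self-adjoint if its quasi-kernel is self-adjoint in $\mathcal H$. If $T$ is a quasi-self-adjoint extension of $\dot A$ with $\rho(T)\neq\emptyset$, a $( * )$-extension of $T$ is $\mathbb A\in[\mathcal H_+,\mathcal H_-]$ with $\mathbb A\supset T\supset\dot A$, $\mathbb A^*\supset T^*\supset\dot A$ and $\mathrm{Re}\,\mathbb A$ a t-self-adjoint bi-extension of $\dot A$. L-system. An array $\Theta=\begin{pmatrix}\mathbb A&K&1\\ \mathcal H_+\subset\mathcal H\subset\mathcal H_-&&\mathbb C\end{pmatrix}$ is an L-system if (1) $T$ is a dissipative ($\mathrm{Im}(Tf,f)\ge0$, $f\in\mathrm{Dom}(T)$) quasi-self-adjoint extension, with $\rho(T)\ne\emptyset$, of a symmetric operator $\dot A$ with deficiency indices $(1,1)$; (2) $\mathbb A$ is a $( * )$-extension of $T$; (3) $\mathrm{Im}\,\mathbb A=KK^*$ with $K\in[\mathbb C,\mathcal H_-]$, $K^*\in[\mathcal H_+,\mathbb C]$. Here $\dot A$, $T$, $\mathbb A$, $K$ are the symmetric, main, state-space and channel operators. Its impedance function is $V_\Theta(z)=K^*(\mathrm{Re}\,\mathbb A-zI)^{-1}K$ for nonreal $z\in\rho(T)$, extended analytically to all of $\mathbb C_\pm$. von Neumann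 parameters (with respect to the given $g_\pm$). For a dissipative quasi-self-adjoint extension $T$: the number $\kappa$, $|\kappa|<1$, with $g_+-\kappa g_-\in\mathrm{Dom}(T)$. For a self-adjoint extension $\hat A$: the number $U$, $|U|=1$, with $g_++Ug_-\in\mathrm{Dom}(\hat A)$. Weyl-Titchmarsh function: for a self-adjoint extension $A$ of $\dot A$, $M_{(\dot A,A)}(z)=((Az+I)(A-zI)^{-1}g,g)$, where $g\in\operatorname{Ker}(\dot A^*-iI)$ has $\|g\|=1$ in the norm of $\mathcal H$ (e.g. $g=\sqrt2\,g_+$ for $(+)$-normalized $g_+$); $z\in\mathbb C_+$, with the same formula for $z\in\mathbb C_-$. *)

(* Defs.v *)
From HB Require Import structures.
From mathcomp Require Import all_boot all_order all_algebra.
From mathcomp Require Import sesquilinear.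
From mathcomp Require Import boolp classical_sets functions reals topology normedtype derive.
From mathcomp Require Import complex.

Set Implicit Arguments.
Unset Strict Implicit.
Unset Printing Implicit Defensive.

Import Order.TTheory GRing.Theory Num.Theory.
Import numFieldNormedType.Exports.

Local Open Scope classical_set_scope.
Local Open Scope ring_scope.

(* Complex Hilbert spaces: the inner product is linear in its first argument. *)
HB.mixin Record NormedModule_isHilbert (R : realType) H
    of CompleteNormedModule R[i] H := {
  ip : {dot H for (@Num.conj R[i])};
  ip_norm : forall x : H, ip x x = `|x| ^+ 2
}.

#[short(type="hilbertType")]
HB.structure Definition Hilbert (R : realType) :=
  {H of NormedModule_isHilbert R H & CompleteNormedModule R[i] H}.

Section Operators.
Context {R : realType} {H : hilbertType R}.
Local Notation C := R[i].
Implicit Types (T A : set (H * H)) (f h : H) (z : C).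

(* An unbounded operator in H is represented by its graph; operator inclusion
   is then inclusion of graphs. *)
Definition linear_operator T :=
  [/\ T 0,
      forall (a : C) p q, T p -> T q -> T (a *: p + q)
    & forall h, T (0, h) -> h = 0].

Definition dom T : set H := [set f | exists h, T (f, h)].

(* the value T f, for f in Dom(T) *)
Definition app T f : H := xget 0 [set h | T (f, h)].

Definition adj T : set (H * H) :=
  [set p | forall q, T q -> ip q.2 p.1 = ip q.1 p.2].

Definition densely_defined T := dense (dom T).

Definition symmetric_operator T := T `<=` adj T.

Definition self_adjoint T :=
  [/\ linear_operator T, densely_defined T & adj T = T].

Definition deficiency_space T z : set H := [set f | adj T (f, z *: f)].

Definition one_dimensional (N : set H) :=
  exists2 g, g != 0 & N = [set c *: g | c in [set: C]].

Definition deficiency_indices_11 T :=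
  one_dimensional (deficiency_space T 'i) /\
  one_dimensional (deficiency_space T (- 'i)).

Definition closed_symmetric T :=
  [/\ linear_operator T, densely_defined T, closed T & symmetric_operator T].

(* z \in rho(T): T - zI is a bijection of Dom(T) onto H with bounded inverse *)
Definition resolvent_set T : set C :=
  [set z | exists2 B : {linear H -> H}, continuous B &
     forall f h, T (f, h + z *: f) <-> f = B h].

(* (T - zI)^-1 h *)
Definition resolvent T z h : H := xget 0 [set f | T (f, h + z *: f)].

Definition dissipative T :=
  forall f h, T (f, h) -> 0 <= 'Im (ip h f).

Definition quasi_self_adjoint (adot T : set (H * H)) :=
  [/\ linear_operator T, adot `<=` T, T `<=` adj adot &
      ~ symmetric_operator T].

(* ((A z + I) (A - z I)^-1 g, g) *)
Definition weyl_titchmarsh A (g : H) (z : C) : C :=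
  let f := resolvent A z g in ip (z *: app A f + f) g.

(* the von Neumann parameters kappa (of T) and U (of A), the pair (gp, gm) of
   deficiency vectors being given *)
Definition is_kappa (gp gm : H) T : C -> Prop :=
  unique (fun kappa => `|kappa| < 1 /\ dom T (gp - kappa *: gm)).

Definition is_U (gp gm : H) A : C -> Prop :=
  unique (fun U => `|U| = 1 /\ dom A (gp + U *: gm)).

Lemma ip_sym (f g : H) : ip f g = (ip g f)^*.
Proof. by rewrite (@hermitian_subproof _ _ _ _ ip) expr0 mul1r. Qed.

Lemma ip_lin (g : H) (a : C) (x y : H) : ip (a *: x + y) g = a * ip x g + ip y g.
Proof. by rewrite linearPl. Qed.

Lemma ip_linr (g : H) (a : C) (x y : H) :
  ip g (a *: x + y) = a^* * ip g x + ip g y.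
Proof. by rewrite linearPr. Qed.

Lemma ip_ge0 (f : H) : 0 <= ip f f.
Proof. by rewrite ip_norm exprn_ge0. Qed.

Lemma cauchy_schwarz (f g : H) : `|ip f g| <= `|f| * `|g|.
Proof.
have [->|g0] := eqVneq g 0; first by rewrite linear0r !normr0 mulr0.
have ng0 : 0 < ip g g by rewrite ip_norm exprn_gt0 // normr_gt0.
rewrite -(ler_pXn2r (n := 2)) ?nnegrE ?mulr_ge0 // exprMn -!ip_norm normCK.
have gR : (ip g g)^* = ip g g by rewrite -ip_sym.
have [a aE] : exists a, ip f g = a * ip g g.
  by exists (ip f g / ip g g); rewrite mulfVK // gt_eqF.
have := ip_ge0 ((- a) *: g + f).
rewrite ip_lin !ip_linr rmorphN /= [ip g f]ip_sym aE rmorphM /= gR.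
rewrite !mulNr addNr mulr0 oppr0 add0r addrC subr_ge0 => le_ff.
rewrite (_ : a * _ * _ = a^* * (a * ip g g) * ip g g); first by rewrite ler_pM2r.
by rewrite mulrCA !mulrA.
Qed.

End Operators.

Section RiggedSpace.
Context {R : realType} {H : hilbertType R} (adot : set (H * H)).
Local Notation C := R[i].

Definition plus_pred : {pred H} := mem (dom (adj adot)).

Fact plus_submod_closed : submod_closed plus_pred.
Proof.
split=> [|a x y].
  by rewrite inE; exists 0 => q _ /=; rewrite !linear0r.
rewrite !inE => -[x' hx] [y' hy]; exists (a *: x' + y') => q qA /=.
by rewrite !ip_linr (hx q qA) (hy q qA).
Qed.
HB.instance Definition _ := GRing.isSubmodClosed.Build _ _ plus_pred
  plus_submod_closed.

(* H_+, the domain of adj adot *)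
Record Hplus := MkHplus {Hplus_val : H; _ : Hplus_val \in plus_pred}.
HB.instance Definition _ := [isSub for Hplus_val].
HB.instance Definition _ := [Choice of Hplus by <:].
HB.instance Definition _ := [SubChoice_isSubLmodule of Hplus by <:].

Implicit Types f g : Hplus.

(* (f, g)_+ = (f, g) + (A^* f, A^* g) *)
Definition ip_plus f g : C :=
  ip (val f) (val g) +
  ip (app (adj adot) (val f)) (app (adj adot) (val g)).

Definition norm_plus f : C := sqrtC (ip_plus f f).

(* || u ||_- <= c, the dual norm of a functional u on H_+ *)
Definition norm_minus_le (u : Hplus -> C) (c : C) :=
  forall f, `|u f| <= c * norm_plus f.

Definition minus_pred : {pred Hplus -> C^o} :=
  mem [set u : Hplus -> C^o | linear_for (@Num.conj C \; *%R) u /\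
                            exists c, norm_minus_le u c].

Fact minus_submod_closed : submod_closed minus_pred.
Proof.
split=> [|a u v]; rewrite !inE.
  split; first by move=> b x y /=; rewrite mulr0 addr0.
  by exists 0 => f; rewrite normr0 mul0r.
move=> [ul [c uc]] [vl [d vd]]; split.
  move=> b x y; rewrite !fctE /= [u _]ul [v _]vl /= scalerDr mulrDr addrACA.
  by congr (_ + _ + _ ); rewrite /GRing.scale /= mulrCA.
exists (`|a| * c + d) => f; rewrite !fctE mulrDl.
rewrite (le_trans (ler_normD _ _)) // lerD // normrM -mulrA.
by rewrite ler_wpM2l.
Qed.
HB.instance Definition _ := GRing.isSubmodClosed.Build _ _ minus_pred
  minus_submod_closed.

(* H_-, the space of bounded antilinear functionals on H_+: u represents the
   functional g |-> (u, g).  Antilinear functionals make u |-> (u, g) linear. *)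
Record Hminus := MkHminus {Hminus_val :> Hplus -> C^o;
                           _ : Hminus_val \in minus_pred}.
HB.instance Definition _ := [isSub for Hminus_val].
HB.instance Definition _ := [Choice of Hminus by <:].
HB.instance Definition _ := [SubChoice_isSubLmodule of Hminus by <:].

(* (f, u), the pairing of H_+ and H_- *)
Definition pairing f (u : Hminus) : C := (u f)^*.

Fact emb_subproof (h : H) :
  (fun f : Hplus => ip h (val f)) \in minus_pred.
Proof.
rewrite inE; split=> [a x y|]; first by rewrite -ip_linr -linearP.
exists `|h| => f; rewrite (le_trans (cauchy_schwarz _ _)) // ler_wpM2l //.
rewrite -(sqrCK (normr_ge0 (val f))) ler_sqrtC ?nnegrE ?exprn_ge0 //.
  by rewrite -ip_norm lerDl ip_ge0.
by rewrite addr_ge0 // ip_ge0.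
Qed.

(* the inclusion of H into H_- *)
Definition emb (h : H) : Hminus := MkHminus (emb_subproof h).

(* The Riesz-Berezansky operator R, (f, u) = (f, R u)_+ for f in H_+; the
   representing vector R u exists by the Riesz theorem on H_+. *)
Definition riesz_berezansky (u : Hminus) : Hplus :=
  xget 0 [set g | forall f, pairing f u = ip_plus f g].

Implicit Types (B : Hplus -> Hminus) (K : C -> Hminus).

(* B \in [H_+, H_-] *)
Definition bounded_operator B :=
  linear B /\ exists c, forall f, norm_minus_le (B f) (c * norm_plus f).

(* (B f, g) = (f, B^* g); for B in [H_+, H_-] such a B^* g exists uniquely *)
Definition adjoint B : Hplus -> Hminus :=
  fun g => xget 0 [set u | forall f, B f g = pairing f u].

Definition re_op B : Hplus -> Hminus :=
  fun f => 2^-1 *: (B f + adjoint B f).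

Definition im_op B : Hplus -> Hminus :=
  fun f => (2 * 'i)^-1 *: (B f - adjoint B f).

Definition rank_one (u v : Hminus) : Hplus -> Hminus :=
  fun f => pairing f u *: v.

(* adj adot as an operator from H_+ to H_- *)
Definition adot_star : Hplus -> Hminus := fun f => emb (app (adj adot) (val f)).

(* The restriction of B to {f | B f \in H}, as an operator in H.  For an
   operator T in H, T `<=` quasi_kernel B says that B extends T. *)
Definition quasi_kernel B : set (H * H) :=
  [set p | exists2 f, val f = p.1 & B f = emb p.2].

Definition self_adjoint_bi_extension B :=
  [/\ bounded_operator B, adot `<=` quasi_kernel B & adjoint B = B].

Definition t_self_adjoint B :=
  self_adjoint_bi_extension B /\ self_adjoint (quasi_kernel B).

Definition star_extension (T : set (H * H)) B :=
  [/\ quasi_self_adjoint adot T /\ resolvent_set T !=set0,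
      bounded_operator B,
      T `<=` quasi_kernel B /\ adot `<=` T,
      adj T `<=` quasi_kernel (adjoint B) /\ adot `<=` adj T
    & t_self_adjoint (re_op B)].

Definition bounded_channel K :=
  linear K /\ exists c, forall w, norm_minus_le (K w) (c * `|w|).

(* (K c, f) = (c, K^* f) *)
Definition channel_adjoint K : Hplus -> C :=
  fun f => xget 0 [set w | forall c, K c f = c * w^*].

Record lsystem := Lsystem {
  main_op : set (H * H);
  state_op : Hplus -> Hminus;
  channel_op : C -> Hminus
}.

Definition is_lsystem (Theta : lsystem) :=
  let T := main_op Theta in
  let A := state_op Theta in
  let K := channel_op Theta in
  [/\ closed_symmetric adot /\ deficiency_indices_11 adot,
      [/\ quasi_self_adjoint adot T, dissipative T & resolvent_set T !=set0],
      star_extension T A,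
      bounded_channel K
    & im_op A = K \o channel_adjoint K].

(* V is the impedance function K^* (Re A - z I)^-1 K, a map from C to C
   identified with a scalar.  The inverse of Re A - z I is only defined on the
   range of this operator, which contains K c but is not all of H_-. *)
Definition is_impedance (Theta : lsystem) (V : C -> C) :=
  let K := channel_op Theta in
  let B (z : C) := fun f => re_op (state_op Theta) f - z *: emb (val f) in
  (forall z, 'Im z != 0 -> resolvent_set (main_op Theta) z ->
     injective (B z) /\
     forall c, exists2 f, B z f = K c & V z * c = channel_adjoint K f) /\
  (forall z, 'Im z != 0 -> derivable (V : C^o -> C^o) z 1).

End RiggedSpace.

Arguments emb {R H adot}.

(* Main.v *)
Require Import Defs.
From HB Require Import structures.
From mathcomp Require Import all_boot all_order all_algebra.
From mathcomp Require Import boolp classical_sets functions reals topology.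
From mathcomp Require Import normedtype derive complex.
From mathcomp Require Import interval_inference.
From mathcomp Require Import ring.

Set Implicit Arguments.
Unset Strict Implicit.
Unset Printing Implicit Defensive.

Import Order.TTheory GRing.Theory Num.Theory.
Import numFieldNormedType.Exports.

Local Open Scope classical_set_scope.
Local Open Scope ring_scope.

(* Write f+ and f- for the (+)-inner products of f with gp and gm.  Projecting
   graphs onto the closed graph of adot gives Dom(adot) = {f+ = f- = 0}, and
   Green's formula reads
     (adot^* f, h) - (f, adot^* h) = i (f+ conj(h+) - f- conj(h-)).
   Hence Dom(A) = {f+ + f- = 0}, a dissipative quasi-self-adjoint extension has
   domain {f- + kappa f+ = 0}, and every operator occurring in the theorem is
   adot^* plus a rank one term with values in a line of H_- that meets H
   trivially, so its quasi-kernel can be read off.  The impedance of Theta10 at z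
   is computed on the vector gp + (z - i) (A - z)^-1 gp of Ker(adot^* - z).
   Conversely, Re of a state-space operator with quasi-kernel A is
   adot^* + (f+ + f-) u with u in H_-; symmetry fixes u up to a real parameter,
   and the single value V(-i) = M(-i) = -i, taken on gm, fixes this parameter
   and the channel vector; then T is restricted to {f- = 0}. *)

(** * Projections and orthogonality *)

Section InnerProduct.
Context {R : realType} {H : hilbertType R}.
Local Notation C := R[i].
Implicit Types (f g h : H) (a c d e : C) (p q s m : H * H).

Lemma ip0l g : ip 0 g = 0 :> C.
Proof.
by apply: (@addrI _ (ip 0 g)); rewrite -{1}[ip 0 g]mul1r -ip_lin scaler0 !addr0.
Qed.
Lemma ip0r g : ip g 0 = 0 :> C.
Proof. by rewrite ip_sym ip0l conjC0. Qed.
Lemma ipDl f g h : ip (f + g) h = ip f h + ip g h.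
Proof. by rewrite -{1}[f]scale1r ip_lin mul1r. Qed.
Lemma ipZl a f h : ip (a *: f) h = a * ip f h.
Proof. by rewrite -[a *: f]addr0 ip_lin ip0l addr0. Qed.
Lemma ipNl f h : ip (- f) h = - ip f h.
Proof. by rewrite -scaleN1r ipZl mulN1r. Qed.
Lemma ipBl f g h : ip (f - g) h = ip f h - ip g h.
Proof. by rewrite ipDl ipNl. Qed.
Lemma ipDr f g h : ip h (f + g) = ip h f + ip h g.
Proof. by rewrite -{1}[f]scale1r ip_linr rmorph1 mul1r. Qed.
Lemma ipZr a f h : ip h (a *: f) = a^* * ip h f.
Proof. by rewrite -[a *: f]addr0 ip_linr ip0r addr0. Qed.
Lemma ipNr f h : ip h (- f) = - ip h f.
Proof. by rewrite -scaleN1r ipZr rmorphN rmorph1 mulN1r. Qed.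
Lemma ipBr f g h : ip h (f - g) = ip h f - ip h g.
Proof. by rewrite ipDr ipNr. Qed.

Definition ipE := (ipDl, ipBl, ipNl, ipZl, ipDr, ipBr, ipNr, ipZr).

Lemma ip_eq0 f : (ip f f == 0) = (f == 0).
Proof. by rewrite ip_norm expf_eq0 normr_eq0. Qed.

Lemma ip_conj f g : (ip f g)^* = ip g f.
Proof. by rewrite -ip_sym. Qed.

Definition ip2 p q : C := ip p.1 q.1 + ip p.2 q.2.

Lemma ip2_sym p q : (ip2 p q)^* = ip2 q p.
Proof. by rewrite /ip2 rmorphD /= !ip_conj. Qed.
Lemma ip2Dl p q s : ip2 (p + q) s = ip2 p s + ip2 q s.
Proof. by rewrite /ip2 /= !ipE; ring. Qed.
Lemma ip2Zl a p s : ip2 (a *: p) s = a * ip2 p s.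
Proof. by rewrite /ip2 /= !ipE; ring. Qed.
Lemma ip2Bl p q s : ip2 (p - q) s = ip2 p s - ip2 q s.
Proof. by rewrite /ip2 /= !ipE; ring. Qed.
Lemma ip2Br p q s : ip2 s (p - q) = ip2 s p - ip2 s q.
Proof. by rewrite /ip2 /= !ipE; ring. Qed.
Lemma ip2Zr a p s : ip2 s (a *: p) = a^* * ip2 s p.
Proof. by rewrite /ip2 /= !ipE; ring. Qed.
Lemma ip2_ge0 p : 0 <= ip2 p p.
Proof. by rewrite addr_ge0 ?ip_ge0. Qed.
Lemma ip2_eq0 p : ip2 p p = 0 -> p = 0.
Proof.
move=> /eqP; rewrite paddr_eq0 ?ip_ge0 // !ip_eq0 => /andP[/eqP p1 /eqP p2].
by case: p p1 p2 => /= ? ? -> ->.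
Qed.

Lemma near_orthogonal m s d e :
  (forall c, d <= ip2 (m - c *: s) (m - c *: s)) -> ip2 m m <= d + e ->
  `|ip2 m s| ^+ 2 <= e * ip2 s s.
Proof.
move=> dmin mde; have [s0|s0] := eqVneq (ip2 s s) 0.
  by rewrite (ip2_eq0 s0) /ip2 /= !ip0r addr0 normr0 expr0n /= mulr0.
have spos : 0 < ip2 s s by rewrite lt_neqAle eq_sym s0 ip2_ge0.
set c := ip2 m s / ip2 s s.
have cE : c * ip2 s s = ip2 m s by rewrite mulfVK.
have := le_trans mde (lerD (dmin c) (lexx e)).
have -> : ip2 (m - c *: s) (m - c *: s) = ip2 m m - c * (ip2 m s)^*.
  by rewrite ip2_sym ip2Bl !ip2Br !ip2Zl !ip2Zr -cE; ring.
rewrite -addrA lerDl addrC subr_ge0 => le_ce.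
have := ler_wpM2r (ltW spos) le_ce; rewrite mulrAC cE normCK.
by [].
Qed.

Lemma dense_orthogonal (D : set H) h :
  dense D -> (forall f, D f -> ip f h = 0) -> h = 0.
Proof.
move=> dD Dh; apply/eqP/negPn/negP => h0.
have hp : 0 < `|h| by rewrite normr_gt0.
have [|f [hf Df]] := dD (ball h `|h|) _ (ball_open _ _).
  by exists h; exact: ballxx.
move: hf; rewrite -ball_normE /= => hf.
have := cauchy_schwarz (h - f) h.
rewrite ipBl (Dh _ Df) subr0 ip_norm normrX normr_id expr2 => /le_lt_trans.
by move=> /(_ (`|h| * `|h|)); rewrite ltxx ltr_pM2r // => /(_ hf).
Qed.

Lemma near_harmonic_lt e : 0 < e -> \forall n \near \oo, n.+1%:R^-1 < e.
Proof.
move=> e0; have er := RRe_real (gtr0_real e0).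
have re0 : 0 < complex.Re e by rewrite -(ltcR 0) er.
near=> n; rewrite -er -[_^-1]/(_^-1 : C) -(rmorph_nat (real_complex R)) -fmorphV ltcR.
by near: n; exact: (near_infty_natSinv_lt (PosNum re0)).
Unshelve. all: by end_near. Qed.

Lemma minimizing_sequence (T : set (H * H)) p : T 0 ->
  (forall a q s, T q -> T s -> T (a *: q + s)) ->
  exists t : nat -> H * H, forall n, T (t n) /\
    forall s, T s ->
      `|ip2 (p - t n) s| <= n.+1%:R^-1 * sqrtC (ip2 s s).
Proof.
move=> T0 Tlin.
pose q (t : H * H) : R := complex.Re (ip2 (p - t) (p - t)).
have qE t : (q t)%:C%C = ip2 (p - t) (p - t).
  by rewrite RRe_real // ger0_real // ip2_ge0.
have hq : has_inf [set q t | t in T].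
  split; first by exists (q 0), 0.
  by exists 0 => _ [t _ <-]; rewrite -lecR qE ip2_ge0.
pose d := inf [set q t | t in T].
have dle t : T t -> d%:C%C <= ip2 (p - t) (p - t).
  by move=> Tt; rewrite -qE lecR; apply: ge_inf; [case: hq | exists t].
pose e n : R := (n.+1%:R^-1) ^+ 2.
have /choice[t tP] n : exists t, T t /\ q t < d + e n.
  have [|_ [t Tt <-] qt] := inf_adherent (E := [set q t | t in T]) (eps := e n) _ hq.
    by rewrite exprn_gt0 // invr_gt0 ltr0n.
  by exists t.
exists t => n; have [Tt qt] := tP n; split=> // s Ts.
have h0 : 0 <= n.+1%:R^-1 * sqrtC (ip2 s s).
  by rewrite mulr_ge0 ?invr_ge0 ?ler0n // sqrtC_ge0 ip2_ge0.
rewrite -(ler_pXn2r (n := 2)) ?nnegrE // exprMn sqrtCK.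
apply: (@near_orthogonal _ _ d%:C%C) => [c|].
  by rewrite -addrA -opprD [t n + _]addrC; apply: dle; exact: Tlin.
rewrite -qE (_ : _ ^+ 2 = (e n)%:C%C) -?rmorphD ?lecR ?(ltW qt) //=.
by rewrite rmorphXn fmorphV rmorph_nat.
Qed.

Lemma minimizing_cauchy (T : set (H * H)) p (t : nat -> H * H) :
  (forall a q s, T q -> T s -> T (a *: q + s)) ->
  (forall n, T (t n) /\ forall s, T s ->
      `|ip2 (p - t n) s| <= n.+1%:R^-1 * sqrtC (ip2 s s)) ->
  forall n m : nat, sqrtC (ip2 (t n - t m) (t n - t m)) <= n.+1%:R^-1 + m.+1%:R^-1.
Proof.
move=> Tlin tP n m; set s := t n - t m; set L := sqrtC _.
have Ts : T s.
  by rewrite /s addrC -scaleN1r; apply: Tlin; [case: (tP m) | case: (tP n)].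
have [_ /(_ _ Ts) bn] := tP n; have [_ /(_ _ Ts) bm] := tP m.
have L0 : 0 <= L by rewrite sqrtC_ge0 ip2_ge0.
have [->|Ln0] := eqVneq L 0; first by rewrite addr_ge0 ?invr_ge0 ?ler0n.
rewrite -(ler_pM2r (_ : 0 < L)) ?lt_neqAle 1?eq_sym ?Ln0 //.
rewrite -expr2 sqrtCK mulrDl -[leLHS]ger0_norm ?ip2_ge0 //.
have -> : ip2 s s = ip2 (p - t m) s - ip2 (p - t n) s.
  by rewrite -ip2Bl opprB addrC subrKA.
by rewrite (le_trans (ler_normB _ _)) // addrC lerD.
Qed.

Lemma norm_fst_le p : `|p.1| <= sqrtC (ip2 p p).
Proof.
rewrite -(ler_pXn2r (n := 2)) ?nnegrE ?sqrtC_ge0 ?ip2_ge0 ?normr_ge0 //.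
by rewrite sqrtCK -ip_norm lerDl ip_ge0.
Qed.

Lemma norm_snd_le p : `|p.2| <= sqrtC (ip2 p p).
Proof.
rewrite -(ler_pXn2r (n := 2)) ?nnegrE ?sqrtC_ge0 ?ip2_ge0 ?normr_ge0 //.
by rewrite sqrtCK -ip_norm lerDr ip_ge0.
Qed.

Lemma harmonic_cauchy_cvg (x : nat -> H) :
  (forall n m : nat, `|x n - x m| <= n.+1%:R^-1 + m.+1%:R^-1) -> cvg (x @ \oo).
Proof.
move=> xc; apply: cauchy_cvg; apply: cauchy_exP => e e0.
have [N _ NP] := near_harmonic_lt (divr_gt0 e0 (ltr0Sn _ 1)).
exists (x N); exists N => // n /= Nn; rewrite -ball_normE /=.
apply: (le_lt_trans (xc N n)); rewrite [ltRHS](splitr e) ltrD //; apply: NP => //=.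
Qed.

Lemma le_mul_eps (v K : C) : 0 <= K ->
  (forall e, 0 < e -> v <= e * K) -> v <= 0.
Proof.
move=> K0 vK; have v1 := vK 1 ltr01.
have vr : v \is Num.real by rewrite (ler_real v1) mul1r ger0_real.
rewrite real_leNgt // ?real0; apply/negP => v0.
have K1 : 0 < K + 1 by rewrite ltr_wpDl.
have := vK _ (divr_gt0 v0 K1); rewrite -mulrAC ler_pdivlMr // ler_pM2l //.
by rewrite gerDl ler10.
Qed.

Lemma projection_exists (T : set (H * H)) p : T 0 ->
  (forall a q s, T q -> T s -> T (a *: q + s)) -> closed T ->
  exists2 l, T l & forall s, T s -> ip2 (p - l) s = 0.
Proof.
move=> T0 Tlin Tcl; have [t tP] := minimizing_sequence p T0 Tlin.
have tc := minimizing_cauchy Tlin tP.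
have c1 : cvg ((fun n => (t n).1) @ \oo).
  apply: harmonic_cauchy_cvg => n m.
  exact: le_trans (norm_fst_le (t n - t m)) (tc n m).
have c2 : cvg ((fun n => (t n).2) @ \oo).
  apply: harmonic_cauchy_cvg => n m.
  exact: le_trans (norm_snd_le (t n - t m)) (tc n m).
set l1 := lim _ in c1; set l2 := lim _ in c2.
have tl : t @ \oo --> (l1, l2).
  have -> : t = fun n => ((t n).1, (t n).2) by apply/funext => n; case: (t n).
  exact: cvg_pair.
exists (l1, l2).
  by apply: closed_cvg Tcl _ _ tl; apply: nearW => n; case: (tP n).
move=> s Ts; apply/normr0_eq0/le_anti/andP; split => //.
apply: (@le_mul_eps _ (sqrtC (ip2 s s) + (`|s.1| + `|s.2|))).
  by rewrite !addr_ge0 // sqrtC_ge0 ip2_ge0.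
move=> e e0.
have [n [n1 n2 n3]] : exists n, [/\ n.+1%:R^-1 < e, `|l1 - (t n).1| < e &
    `|l2 - (t n).2| < e].
  near \oo => n; exists n; split; first by near: n; exact: near_harmonic_lt.
    by near: n; exact: (@cvgr_dist_lt _ H _ _ _ (fun n => (t n).1) l1 c1 e e0).
  by near: n; exact: (@cvgr_dist_lt _ H _ _ _ (fun n => (t n).2) l2 c2 e e0).
have -> : p - (l1, l2) = p - t n - ((l1, l2) - t n) by rewrite opprB subrKA.
rewrite ip2Bl (le_trans (ler_normB _ _)) // mulrDr lerD //.
  have [_ /(_ _ Ts)] := tP n; move/le_trans; apply.
  by rewrite ler_wpM2r ?sqrtC_ge0 ?ip2_ge0 // ltW.
rewrite /ip2 (le_trans (ler_normD _ _)) // mulrDr lerD //.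
  by rewrite (le_trans (cauchy_schwarz _ _)) // ler_wpM2r // ltW.
by rewrite (le_trans (cauchy_schwarz _ _)) // ler_wpM2r // ltW.
Unshelve. all: by end_near. Qed.

End InnerProduct.

(** * Resolvents of self-adjoint operators *)

Section SelfAdjoint.
Context {R : realType} {H : hilbertType R}.
Local Notation C := R[i].
Implicit Types (f g h : H) (z w : C) (T A : set (H * H)).

Lemma adj_submod T (a : C) (p q : H * H) :
  adj T p -> adj T q -> adj T (a *: p + q).
Proof. by move=> pT qT s sT /=; rewrite !ip_linr (pT _ sT) (qT _ sT). Qed.

Lemma adj_0 T : adj T 0.
Proof. by move=> q _; rewrite !ip0r. Qed.

Lemma adj_closed T : closed (adj T).
Proof.
move=> p pcl q qT; apply/eqP; rewrite -subr_eq0; apply/eqP.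
apply/normr0_eq0/le_anti/andP; split => //.
apply: (@le_mul_eps _ _ (`|q.2| + `|q.1|)); first by rewrite addr_ge0.
move=> e e0; have [p' [p'T [/= b1 b2]]] := pcl _ (nbhsx_ballx p _ e0).
have -> : ip q.2 p.1 - ip q.1 p.2 = ip q.2 (p.1 - p'.1) + ip q.1 (p'.2 - p.2).
  by rewrite !ipBr (p'T _ qT) addrA subrK.
move: b1 b2; rewrite -!ball_normE /= => b1 b2.
rewrite (le_trans (ler_normD _ _)) // mulrDr lerD //.
  rewrite (le_trans (cauchy_schwarz _ _)) // mulrC ler_wpM2r //.
  exact: ltW.
rewrite (le_trans (cauchy_schwarz _ _)) // mulrC ler_wpM2r //.
by rewrite distrC ltW.
Qed.

Lemma app_eq T f h : linear_operator T -> T (f, h) -> app T f = h.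
Proof.
move=> [T0 Tlin Tun] Tfh; apply: xget_unique => // k Tfk.
have := Tlin (-1) _ _ Tfh Tfk; rewrite /= !scaleN1r => Tk.
by apply/eqP; rewrite -subr_eq0 addrC; apply/eqP/Tun; rewrite -(addNr f).
Qed.

Lemma self_adjoint_solvable_i A h : adj A = A -> exists f, A (f, h + 'i *: f).
Proof.
move=> adjA.
have lin (a : C) p q : A p -> A q -> A (a *: p + q).
  by rewrite -adjA; exact: adj_submod.
have A0 : A 0 by rewrite -adjA; exact: adj_0.
have clA : closed A by rewrite -adjA; exact: adj_closed.
have [[x y] Axy ort] := projection_exists (0, h) A0 lin clA.
have Ar : A (h - y, x).
  rewrite -adjA => q Aq /=; have := ort _ Aq.
  rewrite /ip2 /= sub0r -[ip (h - y) _]ip_conj ipNl -(ip_conj q.1 x).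
  by move=> /eqP; rewrite addrC subr_eq0 => /eqP/(can_inj (@conjCK C)).
exists ('i *: (h - y) + x).
have := lin 'i _ _ Ar Axy; congr (A (_, _)) => /=.
by rewrite scalerDr scalerA -expr2 sqrCi scaleN1r opprB addrCA addrA subrK addrC.
Qed.

Lemma self_adjoint_solvable A z h : adj A = A -> 'Im z != 0 ->
  exists f, A (f, h + z *: f).
Proof.
move=> adjA b0; pose a := 'Re z; pose b := 'Im z.
have aR : a^* = a by rewrite conj_Creal ?Creal_Re.
have bR : b^* = b by rewrite conj_Creal ?Creal_Im.
pose A' : set (H * H) := [set p | A (p.1, b *: p.2 + a *: p.1)].
have adjA' : adj A' = A'.
  apply/seteqP; split=> p pA'.
    rewrite /A' /= -adjA => -[f k] Afk /=.
    have := pA' (f, b^-1 *: (k - a *: f)); rewrite /A' /= => /(_ _)/=.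
    rewrite scalerA mulfV // scale1r subrK => /(_ Afk).
    rewrite !ipE aR bR => <-; field; exact: b0.
  move=> q; rewrite /A' /= => qA'.
  have pA : adj A (p.1, b *: p.2 + a *: p.1) by rewrite adjA.
  have := pA _ qA'; rewrite /= !ipE aR bR => /addIr/(mulfI b0).
  by [].
have [f] := self_adjoint_solvable_i (b^-1 *: h) adjA'; rewrite /A' /= => Af.
exists f; move: Af; congr (A (_, _)); rewrite scalerDr !scalerA mulfV //.
by rewrite scale1r -addrA -scalerDl addrC [z]Crect mulrC [_ + a]addrC addrC.
Qed.

Lemma symmetric_bound A f h z : symmetric_operator A -> A (f, h + z *: f) ->
  `|z - z^*| * `|f| <= 2 * `|h|.
Proof.
move=> Asym Af; have := Asym _ Af _ Af; rewrite /= !ipE => fh.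
have [->|f0] := eqVneq f 0; first by rewrite normr0 mulr0 mulr_ge0 ?normr_ge0.
rewrite -(ler_pM2r (_ : 0 < `|f|)) ?normr_gt0 // -mulrA -expr2 -ip_norm.
rewrite -[ip f f]ger0_norm ?ip_ge0 // -normrM.
have -> : (z - z^*) * ip f f = ip f h - ip h f.
  have /eqP := fh; rewrite -subr_eq0 => /eqP fh0.
  by rewrite -[RHS]addr0 -fh0; ring.
rewrite (le_trans (ler_normB _ _)) // -mulrA mulr_natl mulr2n lerD //.
  by rewrite mulrC cauchy_schwarz.
exact: cauchy_schwarz.
Qed.

Lemma nonreal_sub_conj z : 'Im z != 0 -> 0 < `|z - z^*|.
Proof.
move=> z0; rewrite normr_gt0; apply: contra z0; rewrite subr_eq0 => /eqP zz.
by apply/eqP/Creal_ImP/CrealP.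
Qed.

Lemma nonreal_shift z w : `|w| < `|z - z^*| / 4 -> 'Im (w + z) != 0.
Proof.
move=> hd; apply/negP => /eqP/Creal_ImP/CrealP; rewrite rmorphD /= => hz.
have zh : z - z^* = w^* - w.
  by apply/eqP; rewrite subr_eq addrAC eq_sym subr_eq hz addrC.
have : `|z - z^*| <= 2 * `|w|.
  rewrite zh (le_trans (ler_normB _ _)) // norm_conjC mulr_natl mulr2n.
  by [].
move: hd; rewrite ltr_pdivlMr // => hd d2.
have : `|z - z^*| <= `|w| * 4.
  by rewrite (le_trans d2) // mulrC ler_wpM2l // ler_nat.
by move=> /le_lt_trans/(_ hd); rewrite ltxx.
Qed.

Lemma resolventP A z h : adj A = A -> 'Im z != 0 ->
  A (resolvent A z h, h + z *: resolvent A z h).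
Proof.
move=> adjA z0; apply: (@xgetPex _ 0 [set f | A (f, h + z *: f)]).
exact: self_adjoint_solvable.
Qed.

Lemma weyl_titchmarshE A z g : self_adjoint A -> 'Im z != 0 ->
  weyl_titchmarsh A g z =
    z * ip g g + (1 + z ^+ 2) * ip (resolvent A z g) g.
Proof.
move=> [Al _ adjA] z0; rewrite /weyl_titchmarsh /=.
by rewrite (app_eq Al (resolventP g adjA z0)) !ipE; ring.
Qed.

Lemma derivable_resolvent A z g : self_adjoint A -> 'Im z != 0 ->
  derivable ((fun w => ip (resolvent A w g) g) : C^o -> C^o) z 1.
Proof.
move=> [Al _ adjA] z0; set F := fun w => _.
have Asym : symmetric_operator A by rewrite /symmetric_operator adjA.
have zc0 : 'Im z^* != 0 by rewrite Im_conj oppr_eq0.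
pose k := resolvent A z^* g; pose f := resolvent A z g.
have kP : A (k, g + z^* *: k) := resolventP g adjA zc0.
have fP : A (f, g + z *: f) := resolventP g adjA z0.
pose d := `|z - z^*|; have d0 : 0 < d := nonreal_sub_conj z0.
apply/cvg_ex; exists (ip f k); apply/cvgrPdist_lt => e e0.
have K0 : 0 < 4 * `|f| * `|k| + 1 by rewrite ltr_wpDl // !mulr_ge0.
near=> h.
have h0 : h != 0 by near: h; exact: nbhs_dnbhs_neq.
have hd : `|h| < d / 4 by near: h; apply: dnbhs0_lt; rewrite divr_gt0.
have he : `|h| < d * e / (4 * `|f| * `|k| + 1).
  by near: h; apply: dnbhs0_lt; rewrite divr_gt0 ?mulr_gt0.
rewrite /= /GRing.scale /= mulr1.
have hz0 : 'Im (h + z) != 0 by exact: nonreal_shift.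
have := resolventP g adjA hz0; set fh := resolvent A (h + z) g => fhP.
have dP : A (fh - f, h *: fh + z *: (fh - f)).
  have [_ Alin _] := Al; have := Alin (-1) _ _ fP fhP.
  congr (A (_, _)) => /=; first by rewrite scaleN1r addrC.
  rewrite scaleN1r scalerDl scalerBr opprD addrACA addNr add0r.
  by rewrite addrCA [- _ + _]addrC.
have quot : ip fh g - ip f g = h * ip fh k.
  have := Asym _ kP _ dP; rewrite /= !ipE conjCK => /eqP.
  rewrite -subr_eq0 => /eqP E; rewrite -[LHS]addr0 -E; ring.
rewrite /F -/fh -/f quot mulKf // -ipBl.
apply: (le_lt_trans (cauchy_schwarz _ _)); rewrite -(ltr_pM2l d0) mulrA.
have bnd : d * `|f - fh| <= 4 * `|h| * `|f|.
  have := symmetric_bound Asym dP; rewrite -/d normrZ distrC => le1.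
  have le2 : `|fh| <= `|f| + `|f - fh|.
    by rewrite -{1}[fh](subrK f) addrC distrC ler_normD.
  have le3 : 4 * `|h| * `|f - fh| <= d * `|f - fh|.
    by rewrite ler_wpM2r // mulrC -ler_pdivlMr // ltW.
  have le4 : 2 * (`|h| * `|fh|) <= 2 * (`|h| * (`|f| + `|f - fh|)).
    by rewrite !ler_wpM2l.
  move: (le_trans le1 le4); set D := d * _ in le3 *; rewrite !mulrDr => le5.
  rewrite -(lerD2r (D + 4 * `|h| * `|f - fh|)).
  have := lerD (ler_wpM2l (ler0n C 2) le5) le3.
  by congr (_ <= _); ring.
apply: (le_lt_trans (ler_wpM2r _ bnd)) => //.
move: he; rewrite ltr_pdivlMr // => /(le_lt_trans _); apply.
rewrite mulrDr mulr1 -[leLHS]addr0 lerD // le_eqVlt; apply/orP; left.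
by apply/eqP; ring.
Unshelve. all: by end_near. Qed.

Lemma derivable_weyl_titchmarsh A z g : self_adjoint A -> 'Im z != 0 ->
  derivable (weyl_titchmarsh A g : C^o -> C^o) z 1.
Proof.
move=> Asa z0.
have D := @derivable_resolvent A z g Asa z0.
have I : derivable (id : C^o -> C^o) z 1 := @derivable_id C C^o z 1.
have K c : derivable (cst c : C^o -> C^o) z 1 := @derivable_cst C C^o C^o c z 1.
have := derivableD (derivableM I (K (ip g g)))
  (derivableM (derivableD (K 1) (derivableM I I)) D).
apply: near_eq_derivable; near=> w.
rewrite weyl_titchmarshE //= -[w](subrK z); apply: nonreal_shift.
near: w; have e0 : 0 < `|z - z^*| / 4 by rewrite divr_gt0 // nonreal_sub_conj.
apply: filterS (nbhsx_ballx (z : C^o) _ e0) => w.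
by rewrite -ball_normE /= distrC.
Unshelve. all: by end_near. Qed.

End SelfAdjoint.

(** * Extensions of a symmetric operator with deficiency indices (1,1) *)

Lemma one_dimensional_span (R : realType) (H : hilbertType R) (N : set H) (g f : H) :
  one_dimensional N -> N g -> g != 0 -> N f -> exists c : R[i], f = c *: g.
Proof.
move=> [g0 _ ->] [c _ <-] cg0 [d _ <-]; exists (d / c).
by rewrite scalerA mulfVK //; apply: contra cg0 => /eqP ->; rewrite scale0r.
Qed.

Section Extensions.
Context {R : realType} {H : hilbertType R} (adot : set (H * H)).
Local Notation C := R[i].
Local Notation star f := (app (adj adot) (val f)).
Local Notation graph f := ((val f, star f) : H * H).
Implicit Types (f h : Hplus adot) (a c d z kappa : C) (T A : set (H * H)).

Context (adot_dense : densely_defined adot).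

Lemma val_plus0 : val (0 : Hplus adot) = 0. Proof. exact: linear0. Qed.
Lemma val_plusD f h : val (f + h) = val f + val h. Proof. exact: linearD. Qed.
Lemma val_plusB f h : val (f - h) = val f - val h. Proof. exact: linearB. Qed.
Lemma val_plusZ a f : val (a *: f) = a *: val f. Proof. exact: linearZ. Qed.

Lemma star_graph f : adj adot (graph f).
Proof. by have := valP f; rewrite inE => /(xgetPex 0). Qed.

Lemma star_eq f k : adj adot (val f, k) -> star f = k.
Proof.
move=> fk; apply/eqP; rewrite -subr_eq0; apply/eqP.
apply: (dense_orthogonal adot_dense) => q [y qy].
by rewrite ipBr -(star_graph f qy) -(fk _ qy) subrr.
Qed.

Lemma star_lift x y : adj adot (x, y) -> exists f, graph f = (x, y).
Proof.
move=> xy; have xP : x \in plus_pred adot by rewrite inE; exists y.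
by exists (MkHplus xP); rewrite (@star_eq (MkHplus xP) y xy).
Qed.

Lemma star_linear a f h : star (a *: f + h) = a *: star f + star h.
Proof.
apply: star_eq; rewrite linearP.
exact: (adj_submod a (star_graph f) (star_graph h)).
Qed.

Lemma graph_linear a f h : graph (a *: f + h) = a *: graph f + graph h.
Proof. by rewrite star_linear linearP. Qed.

Lemma starD f h : star (f + h) = star f + star h.
Proof. by have := star_linear 1 f h; rewrite !scale1r. Qed.
Lemma star0 : star (0 : Hplus adot) = 0.
Proof. by apply: star_eq; rewrite linear0; exact: adj_0. Qed.
Lemma starZ a f : star (a *: f) = a *: star f.
Proof. by rewrite -[a *: f]addr0 star_linear star0 addr0. Qed.
Lemma starN f : star (- f) = - star f.
Proof. by rewrite -scaleN1r starZ scaleN1r. Qed.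
Lemma starB f h : star (f - h) = star f - star h.
Proof. by rewrite starD starN. Qed.

Lemma ip_plusE f h : ip_plus f h = ip2 (graph f) (graph h).
Proof. by []. Qed.
Lemma ip_plus_conj f h : (ip_plus f h)^* = ip_plus h f.
Proof. exact: (ip2_sym (graph f) (graph h)). Qed.
Lemma ip_plus_linear a f g h :
  ip_plus (a *: f + g) h = a * ip_plus f h + ip_plus g h.
Proof. by rewrite !ip_plusE graph_linear ip2Dl ip2Zl. Qed.
Lemma ip_plus0 h : ip_plus 0 h = 0 :> C.
Proof. by rewrite /ip_plus star0 val_plus0 !ip0l addr0. Qed.
Lemma ip_plusZ a f h : ip_plus (a *: f) h = a * ip_plus f h.
Proof. by rewrite -[a *: f]addr0 ip_plus_linear ip_plus0 addr0. Qed.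
Lemma ip_plusD f g h : ip_plus (f + g) h = ip_plus f h + ip_plus g h.
Proof. by rewrite -{1}[f]scale1r ip_plus_linear mul1r. Qed.
Lemma ip_plusN f h : ip_plus (- f) h = - ip_plus f h.
Proof. by rewrite -scaleN1r ip_plusZ mulN1r. Qed.
Lemma ip_plusB f g h : ip_plus (f - g) h = ip_plus f h - ip_plus g h.
Proof. by rewrite ip_plusD ip_plusN. Qed.

Definition ip_plus_lin := (ip_plusD, ip_plusB, ip_plusN, ip_plusZ).

Lemma norm_le_plus f : `|val f| <= norm_plus f.
Proof. exact: (norm_fst_le (graph f)). Qed.

Lemma star_le_plus f : `|star f| <= norm_plus f.
Proof. exact: (norm_snd_le (graph f)). Qed.

Context (adot_sym : closed_symmetric adot) (adot_def : deficiency_indices_11 adot).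
Context (gp gm : Hplus adot).
Context (gp_def : deficiency_space adot 'i (val gp))
        (gm_def : deficiency_space adot (- 'i) (val gm))
        (gp_norm : norm_plus gp = 1) (gm_norm : norm_plus gm = 1).

Local Notation plus f := (ip_plus f gp).
Local Notation minus f := (ip_plus f gm).

Lemma adot_sub_star x y : adot (x, y) -> exists f, graph f = (x, y).
Proof. by case: adot_sym => _ _ _ sym /sym/star_lift. Qed.

Lemma star_gp : star gp = 'i *: val gp. Proof. exact: star_eq. Qed.
Lemma star_gm : star gm = - 'i *: val gm. Proof. exact: star_eq. Qed.

Lemma plusE f : plus f = ip (val f) (val gp) - 'i * ip (star f) (val gp).
Proof. by rewrite /ip_plus star_gp ipZr conjCi mulNr. Qed.

Lemma minusE f : minus f = ip (val f) (val gm) + 'i * ip (star f) (val gm).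
Proof. by rewrite /ip_plus star_gm ipZr rmorphN /= conjCi opprK. Qed.

Lemma plus_gp : plus gp = 1.
Proof. by rewrite -[plus gp]sqrtCK [sqrtC _]gp_norm expr1n. Qed.

Lemma minus_gm : minus gm = 1.
Proof. by rewrite -[minus gm]sqrtCK [sqrtC _]gm_norm expr1n. Qed.

Let ii : 'i * 'i = -1 :> C. Proof. by rewrite -expr2 sqrCi. Qed.

Lemma plus_gm : plus gm = 0.
Proof. by rewrite plusE star_gm !ipE; ring: ii. Qed.

Lemma minus_gp : minus gp = 0.
Proof. by rewrite minusE star_gp !ipE; ring: ii. Qed.

Lemma ip_gp : ip (val gp) (val gp) = 2^-1.
Proof.
have := plus_gp; rewrite plusE star_gp !ipE => E.
have : 2 * ip (val gp) (val gp) = 1 by rewrite -[RHS]E; ring: ii.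
by move=> /(canRL (mulKf _)) -> //; rewrite ?mulr1 ?pnatr_eq0.
Qed.

Lemma gp_neq0 : val gp != 0.
Proof.
apply/eqP => g0; have := ip_gp; rewrite g0 ip0l => /eqP.
by rewrite eq_sym invr_eq0 pnatr_eq0.
Qed.

Lemma gm_neq0 : val gm != 0.
Proof.
apply/eqP => g0; have := minus_gm.
by rewrite minusE star_gm g0 scaler0 !ip0r mulr0 addr0 => /eqP; rewrite eq_sym oner_eq0.
Qed.

Lemma eigen_i f : star f = 'i *: val f -> exists c, f = c *: gp.
Proof.
move=> fE; have fN : deficiency_space adot 'i (val f).
  by rewrite /deficiency_space /= -fE; exact: star_graph.
have [c fc] := one_dimensional_span adot_def.1 gp_def gp_neq0 fN.
by exists c; apply: val_inj; rewrite val_plusZ.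
Qed.

Lemma eigen_Ni f : star f = - 'i *: val f -> exists c, f = c *: gm.
Proof.
move=> fE; have fN : deficiency_space adot (- 'i) (val f).
  by rewrite /deficiency_space /= -fE; exact: star_graph.
have [c fc] := one_dimensional_span adot_def.2 gm_def gm_neq0 fN.
by exists c; apply: val_inj; rewrite val_plusZ.
Qed.

(* The residual [r] of the projection of the graph of [f] onto the graph of
   [adot] satisfies [adot^* adot^* r = - r], so it is a combination of the
   deficiency vectors. *)
Lemma adot_graphP f : adot (graph f) <-> plus f = 0 /\ minus f = 0.
Proof.
have [[adot0 adotlin _] _ clos sym] := adot_sym.
have orth h : adot (graph h) -> plus h = 0 /\ minus h = 0.
  move=> hA; have := gp_def hA; have := gm_def hA.
  rewrite /= !ipE rmorphN /= conjCi opprK.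
  by rewrite plusE minusE => -> ->; split; ring: ii.
split=> [/orth//|[pf mf]].
have [[x y] lA ort] := projection_exists (graph f) adot0 adotlin clos.
have [f0 f0E] := adot_sub_star lA.
rewrite -f0E in lA ort; have [pf0 mf0] := orth _ lA.
have rE : graph f - graph f0 = graph (f - f0).
  by rewrite starB val_plusB.
move: ort; rewrite rE; set r := f - f0 => ort.
have [pr mr] : plus r = 0 /\ minus r = 0.
  by rewrite !ip_plusB pf mf pf0 mf0 subrr.
have rdef : r = f - f0 by []; clearbody r.
have [s sE] : exists s : Hplus adot, graph s = (star r, - val r).
  apply: star_lift => q qA /=; rewrite -(ip_conj _ q.2) -(ip_conj _ q.1) ipNl.
  have /eqP := ort _ qA; rewrite /ip2 /= addrC addr_eq0 => /eqP ->.
  by [].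
have [sv ss] : val s = star r /\ star s = - val r by case: sE.
have [c cE] : exists c, s + 'i *: r = c *: gp.
  apply: eigen_i; rewrite starD starZ ss val_plusD val_plusZ sv.
  by rewrite scalerDr scalerA ii scaleN1r addrC.
have [d dE] : exists d, s - 'i *: r = d *: gm.
  apply: eigen_Ni; rewrite starB starZ ss val_plusB val_plusZ sv.
  by rewrite scalerBr scalerA mulNr ii opprK scale1r addrC scaleNr.
have rcd : (2 * 'i) *: r = c *: gp - d *: gm.
  by rewrite -cE -dE opprB addrC subrKA -scalerA scaler_nat mulr2n.
have c0 : c = 0.
  have := congr1 (fun x => plus x) rcd.
  by rewrite ip_plusB !ip_plusZ pr plus_gp plus_gm !mulr0 mulr1 subr0.
have d0 : d = 0.
  have := congr1 (fun x => minus x) rcd.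
  rewrite ip_plusB !ip_plusZ mr minus_gp minus_gm !mulr0 mulr1 sub0r.
  by move=> /eqP; rewrite eq_sym oppr_eq0 => /eqP.
have r0 : r = 0.
  apply/eqP; move/eqP: rcd; rewrite c0 d0 !scale0r subrr scaler_eq0.
  by rewrite mulf_eq0 pnatr_eq0 (negbTE (neq0Ci _)).
by move/eqP: r0; rewrite rdef subr_eq0 => /eqP ->.
Qed.

Lemma adot_residual f : adot (graph (f - plus f *: gp - minus f *: gm)).
Proof.
apply/adot_graphP; rewrite !ip_plus_lin plus_gp plus_gm minus_gp minus_gm.
by split; ring.
Qed.

Lemma conj_plus h : (plus h)^* = ip (val gp) (val h) + 'i * ip (val gp) (star h).
Proof. by rewrite ip_plus_conj /ip_plus star_gp ipZl. Qed.

Lemma conj_minus h : (minus h)^* = ip (val gm) (val h) - 'i * ip (val gm) (star h).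
Proof. by rewrite ip_plus_conj /ip_plus star_gm ipZl mulNr. Qed.

Lemma adot_adjoint f h : adot (graph f) -> ip (star f) (val h) = ip (val f) (star h).
Proof. by move=> /(star_graph h). Qed.

Lemma green f h :
  ip (star f) (val h) - ip (val f) (star h) =
  'i * (plus f * (plus h)^* - minus f * (minus h)^*).
Proof.
have := adot_adjoint h (adot_residual f).
rewrite !starB !starZ star_gp star_gm !val_plusB !val_plusZ !ipE.
rewrite conj_plus conj_minus => /eqP; rewrite -subr_eq0 => /eqP E.
by rewrite -[LHS]subr0 -E; ring: ii.
Qed.

Section SelfAdjointExtension.
Context A (A_sa : self_adjoint A) (adot_A : adot `<=` A).
Context (A_dom : dom A (val gp - val gm)).

Lemma sa_ext_lift x y : A (x, y) -> exists f, graph f = (x, y).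
Proof.
move=> Axy; apply: star_lift; have [_ _ adjA] := A_sa.
by move: Axy; rewrite -adjA => Axy q /adot_A/Axy.
Qed.

Lemma sa_ext_graphP f : A (graph f) <-> plus f + minus f = 0.
Proof.
have [[A0 Alin _] _ adjA] := A_sa.
have Ah : A (graph (gp - gm)).
  have [k Ak] := A_dom; have [h hE] := sa_ext_lift Ak.
  suff -> : gp - gm = h by rewrite hE.
  by apply: val_inj; rewrite val_plusB; have := congr1 fst hE.
split=> [Af|fpm].
  have := Ah; rewrite -{1}adjA => /(_ _ Af) /= E.
  have := green f (gp - gm).
  rewrite E subrr !ip_plusB plus_gp minus_gp plus_gm minus_gm subr0 sub0r.
  rewrite rmorphN !rmorph1 mulrN opprK !mulr1 => /eqP; rewrite eq_sym mulf_eq0.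
  by rewrite (negbTE (neq0Ci _)) => /eqP.
have mf : minus f = - plus f by apply/eqP; rewrite -addr_eq0 addrC fpm.
have fE : plus f *: (gp - gm) + (f - plus f *: gp - minus f *: gm) = f.
  rewrite mf scaleNr opprK scalerBr addrC -addrA.
  by rewrite [_ + (_ - _)]addrCA subrr addr0 subrK.
have := Alin (plus f) _ _ Ah (adot_A (adot_residual f)).
by rewrite -graph_linear fE.
Qed.

Lemma sa_ext_solvable z k : 'Im z != 0 ->
  exists f, A (graph f) /\ star f = k + z *: val f.
Proof.
have [_ _ adjA] := A_sa => z0; have [x Ax] := self_adjoint_solvable k adjA z0.
have [f fE] := sa_ext_lift Ax; exists f; rewrite fE; split=> //.
by have := congr1 fst fE; have := congr1 snd fE; rewrite /= => -> ->.
Qed.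

Lemma sa_ext_eigen z f : 'Im z != 0 -> star f = z *: val f ->
  plus f + minus f = 0 -> f = 0.
Proof.
move=> z0 sf /sa_ext_graphP; rewrite sf -[z *: _]add0r => Af.
have [_ _ adjA] := A_sa.
have Asym : symmetric_operator A by rewrite /symmetric_operator adjA.
have := symmetric_bound Asym Af; rewrite normr0 mulr0.
rewrite pmulr_rle0 ?nonreal_sub_conj // normr_le0 => /eqP f0.
by apply: val_inj; rewrite val_plus0.
Qed.

(* [gp - kappa *: gm] spans its domain modulo [dom adot]. *)
Definition quasi_ext kappa : set (H * H) :=
  [set p | exists2 f, graph f = p & minus f + kappa * plus f = 0].

Lemma quasi_ext_graphP kappa f :
  quasi_ext kappa (graph f) <-> minus f + kappa * plus f = 0.
Proof. by split=> [[h [/val_inj -> _]]|] //; exists f. Qed.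

Lemma quasi_ext_resolvent kappa :
  dissipative (quasi_ext kappa) -> resolvent_set (quasi_ext kappa) (- 'i).
Proof.
move=> diss; have Ni0 : 'Im (- 'i) != 0 :> C by rewrite raddfN /= Im_i oppr_eq0 oner_eq0.
have sol k : exists f, quasi_ext kappa (graph f) /\ star f = k - 'i *: val f.
  have [f [_ fE]] := sa_ext_solvable k Ni0.
  exists (f - (minus f + kappa * plus f) *: gm); split.
    apply/quasi_ext_graphP; rewrite !ip_plus_lin plus_gm minus_gm; ring.
  rewrite starB starZ fE star_gm val_plusB val_plusZ !scaleNr scalerN opprK.
  by rewrite scalerBr opprB addrA scalerA mulrC -scalerA addrAC.
have bound f k : quasi_ext kappa (graph f) -> star f = k - 'i *: val f ->
    `|val f| <= `|k|.
  move=> Tf fE; have := diss _ _ Tf; rewrite fE ipBl ipZl raddfB /= ImMil.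
  have := ip_ge0 (val f); move=> /ger0_real/Creal_ReP ->; rewrite subr_ge0 ip_norm.
  move=> le1; have [->|f0] := eqVneq (val f) 0; first by rewrite normr0.
  rewrite -(ler_pM2r (_ : 0 < `|val f|)) ?normr_gt0 // -expr2 (le_trans le1) //.
  rewrite (le_trans _ (cauchy_schwarz k (val f))) //.
  have -> : 'Im (ip k (val f)) = 'Re (- ('i * ip k (val f))).
    by rewrite raddfN /= ReMil opprK.
  by rewrite (le_trans (leif_Re_Creal _).1) // normrN normrM normCi mul1r.
have [B /all_and2[BT BE]] := choice sol.
have BP k f : quasi_ext kappa (graph f) -> star f = k - 'i *: val f -> f = B k.
  have := BT k; move=> /quasi_ext_graphP hT /quasi_ext_graphP fT fE.
  have [c cE] : exists c, f - B k = c *: gm.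
    apply: eigen_Ni; rewrite starB fE BE val_plusB opprB addrC subrKA.
    by rewrite -scalerBr -opprB scalerN scaleNr.
  apply/eqP; rewrite -subr_eq0 cE; suff -> : c = 0 by rewrite scale0r.
  have : minus (c *: gm) + kappa * plus (c *: gm) = 0.
    rewrite -cE !ip_plusB -[RHS](subrr (minus (B k) + kappa * plus (B k))).
    by rewrite {1}hT -fT; ring.
  by rewrite !ip_plusZ plus_gm minus_gm => <-; ring.
have B_lin : linear (fun k => val (B k)).
  move=> a k l; rewrite -val_plusZ -val_plusD; congr val; apply/esym/BP.
    apply/quasi_ext_graphP; rewrite !ip_plus_lin.
    have /quasi_ext_graphP xT := BT k; have /quasi_ext_graphP yT := BT l.
    by rewrite -[RHS]add0r -{1}(mulr0 a) -{1}xT -yT; ring.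
  rewrite star_linear !BE val_plusD val_plusZ scalerBr scalerDr opprD addrACA.
  by rewrite !scalerA mulrC.
pose BL : {linear H -> H} := HB.pack (fun k => val (B k))
  (GRing.isLinear.Build _ _ _ _ (fun k => val (B k)) B_lin).
exists BL.
  apply: bounded_linear_continuous; apply/linear_boundedP.
  exists 1; split; rewrite ?real1 // => M M1 x /=.
  rewrite (le_trans (_ : _ <= `|x|)) //.
    exact: bound (BT x) (BE x).
  by rewrite ler_peMl // ltW.
move=> x k; rewrite scaleNr; split => [[h hE hT]|->].
  have hx : val h = x by have := congr1 fst hE.
  have hk : star h = k - 'i *: x := congr1 snd hE; rewrite -hx in hk.
  by rewrite -hx (BP k h) //; apply/quasi_ext_graphP.
by have := BT k; rewrite BE.
Qed.

Lemma dissipative_gm T : dissipative T -> ~ T (graph gm).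
Proof.
move=> diss /diss; rewrite star_gm ipZl mulNr raddfN /= ImMil.
have n0 : 0 < ip (val gm) (val gm) by rewrite ip_norm exprn_gt0 // normr_gt0 gm_neq0.
move: (gtr0_real n0) => /Creal_ReP ->; rewrite oppr_ge0.
by move=> /(lt_le_trans n0); rewrite ltxx.
Qed.

Lemma dissipative_qsa_ext T : quasi_self_adjoint adot T -> dissipative T ->
  exists kappa, T = quasi_ext kappa.
Proof.
move=> [[T0 Tlin _] adotT Tadot nsym] diss.
have Tlift x y : T (x, y) -> exists f, graph f = (x, y) by move=> /Tadot/star_lift.
have Tcomb a f h : T (graph f) -> T (graph h) -> T (graph (a *: f + h)).
  by rewrite graph_linear; exact: Tlin.
have noplus f : T (graph f) -> plus f = 0 -> minus f = 0.
  move=> Tf pf; apply/eqP/negPn/negP => mf; apply: (dissipative_gm diss).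
  have := adotT _ (adot_residual f); rewrite pf scale0r subr0.
  move=> /(Tcomb (-1) _ _)/(_ Tf); rewrite scaleN1r opprB subrK => /(Tcomb (minus f)^-1).
  by move=> /(_ 0); rewrite addr0 scalerA mulVf // scale1r star0 val_plus0; apply.
have [f [Tf pf]] : exists f, T (graph f) /\ plus f != 0.
  apply: contra_notP nsym => nof; suff -> : T = adot by case: adot_sym.
  apply/seteqP; split => // -[x y] Txy; have [f fE] := Tlift _ _ Txy.
  rewrite -fE in Txy *; apply/adot_graphP.
  have pf : plus f = 0 by apply: contrapT => /eqP pf; apply: nof; exists f.
  by split => //; exact: noplus.
exists (- minus f / plus f); apply/seteqP; split=> [[x y] Txy|_ [h <- hE]].
  have [h hE] := Tlift _ _ Txy; rewrite -hE in Txy *; apply/quasi_ext_graphP.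
  have := noplus _ (Tcomb (- (plus h / plus f)) _ _ Tf Txy).
  rewrite !ip_plus_lin => E; rewrite -[RHS]E; first by field.
  by rewrite mulNr mulfVK // addNr.
have /adotT : adot (graph (h - (plus h / plus f) *: f)).
  apply/adot_graphP; rewrite !ip_plus_lin; split; first by field.
  by rewrite -[RHS]hE; field.
move=> /(Tcomb (plus h / plus f) _ _ Tf).
by rewrite addrC subrK.
Qed.


(** * Functionals on the space H_+ *)

Implicit Types (u v w : Hminus adot) (B : Hplus adot -> Hminus adot).

Lemma functionalD u v f : (u + v : Hminus adot) f = u f + v f. Proof. by []. Qed.
Lemma functionalN u f : (- u : Hminus adot) f = - u f. Proof. by []. Qed.
Lemma functionalB u v f : (u - v : Hminus adot) f = u f - v f. Proof. by []. Qed.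
Lemma functionalZ a u f : (a *: u : Hminus adot) f = a * u f. Proof. by []. Qed.
Lemma functional0 f : (0 : Hminus adot) f = 0. Proof. by []. Qed.
Lemma embE k f : emb k f = ip k (val f). Proof. by []. Qed.
Definition functionalE := (functionalD, functionalB, functionalN, functionalZ).

Lemma functional_eq u v : (forall f, u f = v f) -> u = v.
Proof. by move=> uv; apply: val_inj; apply/funext. Qed.

Lemma functional_antilinear u a f h : u (a *: f + h) = a^* * u f + u h.
Proof. by have := valP u; rewrite inE => -[-> _]. Qed.

Lemma functional_antilinear0 u : u 0 = 0.
Proof.
have /eqP := functional_antilinear u 1 0 0; rewrite rmorph1 mul1r scaler0 addr0.
by rewrite -subr_eq0 opprD addrA subrr sub0r oppr_eq0 => /eqP.
Qed.
Lemma functional_antilinearZ u a f : u (a *: f) = a^* * u f.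
Proof. by rewrite -[a *: f]addr0 functional_antilinear functional_antilinear0 addr0. Qed.
Lemma functional_antilinearD u f h : u (f + h) = u f + u h.
Proof. by rewrite -{1}[f]scale1r functional_antilinear rmorph1 mul1r. Qed.
Lemma functional_antilinearB u f h : u (f - h) = u f - u h.
Proof.
by rewrite -scaleN1r functional_antilinearD functional_antilinearZ rmorphN1 mulN1r.
Qed.

Lemma functional_bounded u : exists c, norm_minus_le u c.
Proof. by have := valP u; rewrite inE => -[]. Qed.

Lemma riesz_berezanskyP u g : riesz_berezansky u = g -> g != 0 ->
  forall f, u f = ip_plus g f.
Proof.
move=> ug g0 f; have [ex|nex] := pselect (exists h, forall f, pairing f u = ip_plus f h).
  have := xgetPex 0 ex f; rewrite [xget _ _]ug /pairing -(ip_plus_conj f g) => <-.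
  by rewrite conjCK.
by move: g0; rewrite -ug /riesz_berezansky xgetPN ?eqxx // => h hP; apply: nex; exists h.
Qed.

Lemma adjointE B g f : bounded_operator B -> adjoint B g f = (B f g)^*.
Proof.
move=> [Blin [c Bc]].
have uP : (fun f => (B f g)^*) \in minus_pred (adot := adot).
  rewrite inE; split=> [a x y|].
    by rewrite Blin functionalD functionalZ rmorphD rmorphM.
  by exists (c * norm_plus g) => x; rewrite norm_conjC mulrAC; exact: Bc.
have := @xgetPex _ 0 [set v | forall f, B f g = pairing f v].
rewrite -/(adjoint B g) => -> /=; first by rewrite /pairing conjCK.
by exists (MkHminus uP) => x; rewrite /pairing /= conjCK.
Qed.

Lemma bounded_adot_star : bounded_operator (@adot_star _ _ adot).
Proof.
split=> [a f h|].
  by apply: functional_eq => x; rewrite functionalD functionalZ !embE star_linear ip_lin.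
exists 1 => f h; rewrite embE mul1r (le_trans (cauchy_schwarz _ _)) //.
by rewrite ler_pM // ?star_le_plus ?norm_le_plus.
Qed.

Lemma bounded_rank_one u v : bounded_operator (rank_one u v).
Proof.
split=> [a f h|].
  rewrite /rank_one /pairing functional_antilinear rmorphD rmorphM /= conjCK.
  by rewrite scalerDl scalerA.
have [c uc] := functional_bounded u; have [d vd] := functional_bounded v.
exists (c * d) => f h; rewrite functionalZ normrM norm_conjC.
have -> : c * d * norm_plus f * norm_plus h = (c * norm_plus f) * (d * norm_plus h).
  by ring.
exact: ler_pM.
Qed.

Lemma bounded_operator_comb a B1 B2 : bounded_operator B1 -> bounded_operator B2 ->
  bounded_operator (fun f => B1 f + a *: B2 f).
Proof.
move=> [l1 [c B1c]] [l2 [d B2d]]; split=> [b f h|].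
  rewrite l1 l2 scalerDr !scalerA addrACA; congr (_ + _).
  by rewrite scalerDr !scalerA [a * b]mulrC.
exists (c + `|a| * d) => f h; rewrite functionalD functionalZ.
rewrite (le_trans (ler_normD _ _)) // mulrDl mulrDl lerD //; first exact: B1c.
by rewrite normrM -!mulrA ler_wpM2l // mulrA; exact: B2d.
Qed.

Lemma linear_channelE (K : C -> Hminus adot) c : linear K -> K c = c *: K 1.
Proof.
move=> Klin; have K0 : K 0 = 0.
  have /eqP := Klin 1 0 0; rewrite !scale1r addr0.
  by rewrite -subr_eq0 opprD addrA subrr sub0r oppr_eq0 => /eqP.
by have := Klin c 1 0; rewrite K0 !addr0 => <-; rewrite [_ *: 1]mulr1.
Qed.

Lemma channel_adjointE (K : C -> Hminus adot) f : linear K ->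
  channel_adjoint K f = (K 1 f)^*.
Proof.
move=> Klin; apply: xget_unique => [c|w /(_ 1)].
  by rewrite conjCK linear_channelE.
by rewrite mul1r => ->; rewrite conjCK.
Qed.

Lemma emb_separated k k' w : (forall f, adot (graph f) -> w f = 0) ->
  emb k + w = emb k' -> k = k' /\ w = 0.
Proof.
move=> w0 kw; suff kk : k = k'.
  by split=> //; apply: (@addrI _ (emb k)); rewrite kw kk addr0.
apply/esym/eqP; rewrite -subr_eq0; apply/eqP.
apply: (dense_orthogonal adot_dense) => q [y qy].
have [f fE] := adot_sub_star qy; have <- : val f = q by have := congr1 fst fE.
apply: (@can_inj _ _ _ _ (@conjCK C)); rewrite ip_conj conjC0 ipBl -!(embE _ f) -kw.
by rewrite functionalD w0 ?fE // addr0 subrr.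
Qed.

Lemma quasi_kernel_eq B (L : Hplus adot -> C) w :
  (forall f, adot (graph f) -> w f = 0) -> w != 0 ->
  (forall f, B f = emb (star f) + L f *: w) ->
  quasi_kernel B = [set p | exists2 f, graph f = p & L f = 0].
Proof.
move=> w0 wn0 BE; apply/seteqP; split=> [[x y] [f /= <-]|_ [f <- Lf]].
  rewrite BE => /emb_separated[|sf Lw].
    by move=> h hA; rewrite functionalZ w0 // mulr0.
  exists f; first by rewrite sf.
  by apply/eqP; move/eqP: Lw; rewrite scaler_eq0 (negbTE wn0) orbF.
by exists f => //; rewrite BE Lf scale0r addr0.
Qed.

Lemma quasi_ext_linear_operator kappa : linear_operator (quasi_ext kappa).
Proof.
split=> [|a _ _ [f <- fE] [h <- hE]|k [f fk _]].
- exists 0; first by rewrite star0 val_plus0.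
  by rewrite !ip_plus0 mulr0 addr0.
- exists (a *: f + h); first by rewrite graph_linear.
  by rewrite !ip_plus_lin -[RHS]add0r -{1}(mulr0 a) -{1}fE -hE; ring.
- have f0 : f = 0 by apply: val_inj; rewrite val_plus0; have := congr1 fst fk.
  by have := congr1 snd fk; rewrite /= f0 star0 => <-.
Qed.

Lemma quasi_ext0_quasi_self_adjoint : quasi_self_adjoint adot (quasi_ext 0).
Proof.
split; first exact: quasi_ext_linear_operator.
- move=> [x y] xy; have [f fE] := adot_sub_star xy; rewrite -fE in xy *.
  by apply/quasi_ext_graphP; have /adot_graphP[-> ->] := xy; rewrite mulr0 addr0.
- by move=> _ [f <- _]; exact: star_graph.
have Tgp : quasi_ext 0 (graph gp) by apply/quasi_ext_graphP; rewrite minus_gp mul0r addr0.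
move=> /(_ _ Tgp)/(_ _ Tgp); rewrite /= star_gp !ipE conjCi ip_gp => E.
have /eqP : 'i = 0 :> C by rewrite -(subrr ('i * 2^-1)) {2}E; field.
by rewrite (negbTE (neq0Ci _)).
Qed.

Lemma quasi_ext0_dissipative : dissipative (quasi_ext 0).
Proof.
move=> x y [f fxy]; rewrite mul0r addr0 => mf.
have [<- <-] : val f = x /\ star f = y by have := congr1 fst fxy; have := congr1 snd fxy.
have := green f f; rewrite mf mul0r subr0 -[ip (val f) _]ip_conj -normCK => E.
by rewrite ImE -opprB E mulrN mulrA ii mulN1r opprK divr_ge0 ?exprn_ge0 ?ler0n.
Qed.

(** * The L-system Theta10 *)

Section Theta10.
Context (phi psi : Hminus adot).
Context (phiE : forall f, phi f = ip_plus gp f) (psiE : forall f, psi f = ip_plus gm f).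
Local Notation delta := (phi - psi).

Definition state10 : Hplus adot -> Hminus adot :=
  fun f => adot_star f - 'i *: rank_one psi (phi - psi) f.

Definition channel10 : C -> Hminus adot :=
  fun c => c *: ((sqrtC 2)^-1 *: (phi - psi)).

Lemma emb_addZ k c w f : (emb k + c *: w : Hminus adot) f = ip k (val f) + c * w f.
Proof. by []. Qed.

Lemma deltaE f : delta f = (plus f)^* - (minus f)^*.
Proof. by rewrite functionalB phiE psiE !ip_plus_conj. Qed.

Lemma delta_adot f : adot (graph f) -> delta f = 0.
Proof. by move=> /adot_graphP[pf mf]; rewrite deltaE pf mf subrr. Qed.

Lemma delta_gp : delta gp = 1.
Proof. by rewrite deltaE plus_gp minus_gp rmorph1 rmorph0 subr0. Qed.

Lemma delta_neq0 : delta != 0.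
Proof.
by apply/eqP => d0; have /eqP := delta_gp; rewrite d0 functional0 eq_sym oner_eq0.
Qed.

Lemma pairing_phi f : pairing f phi = plus f.
Proof. by rewrite /pairing phiE ip_plus_conj. Qed.

Lemma pairing_psi f : pairing f psi = minus f.
Proof. by rewrite /pairing psiE ip_plus_conj. Qed.

Lemma state10E f : state10 f = emb (star f) + (- 'i * minus f) *: delta.
Proof. by rewrite /state10 /rank_one pairing_psi scalerA -scaleNr mulNr. Qed.

Lemma bounded_state10 : bounded_operator state10.
Proof.
have -> : state10 = fun f => adot_star f + (- 'i) *: rank_one psi delta f.
  by apply/funext => f; rewrite scaleNr.
apply: bounded_operator_comb; [exact: bounded_adot_star | exact: bounded_rank_one].
Qed.

Lemma adjoint_state10E f : adjoint state10 f = emb (star f) + (- 'i * plus f) *: delta.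
Proof.
apply: functional_eq => h; rewrite adjointE; last exact: bounded_state10.
rewrite state10E !emb_addZ !deltaE.
rewrite rmorphD rmorphM rmorphM rmorphB rmorphN /= conjCi !conjCK ip_conj.
apply/eqP; rewrite -subr_eq0; apply/eqP.
have /eqP := green f h; rewrite -subr_eq0 => /eqP E.
by rewrite -[RHS]oppr0 -[X in _ = - X]E; ring.
Qed.

Lemma re_state10E f :
  re_op state10 f = emb (star f) + (- ('i / 2) * (plus f + minus f)) *: delta.
Proof.
apply: functional_eq => h; rewrite /re_op adjoint_state10E state10E.
by rewrite !functionalE; field.
Qed.

Lemma im_state10E f : im_op state10 f = (2^-1 * (plus f - minus f)) *: delta.
Proof.
apply: functional_eq => h; rewrite /im_op adjoint_state10E state10E.
by rewrite !functionalE; field; rewrite neq0Ci.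
Qed.

Lemma bounded_re_state10 : bounded_operator (re_op state10).
Proof.
have -> : re_op state10 =
    fun f => adot_star f + (- ('i / 2)) *: rank_one (phi + psi) delta f.
  apply/funext => f; rewrite re_state10E /rank_one scalerA; congr (_ + (_ * _) *: _).
  by rewrite -pairing_phi -pairing_psi /pairing functionalD rmorphD.
apply: bounded_operator_comb; [exact: bounded_adot_star | exact: bounded_rank_one].
Qed.

Lemma adjoint_re_state10 : adjoint (re_op state10) = re_op state10.
Proof.
apply/funext => f; apply: functional_eq => h.
rewrite adjointE; last exact: bounded_re_state10.
rewrite !re_state10E !emb_addZ !deltaE.
rewrite rmorphD rmorphM rmorphM rmorphB rmorphN rmorphM rmorphD fmorphV rmorph_nat /=.
rewrite conjCi !conjCK ip_conj.
apply/eqP; rewrite -subr_eq0; apply/eqP.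
have /eqP := green f h; rewrite -subr_eq0 => /eqP E.
by rewrite -[RHS]oppr0 -[X in _ = - X]E; field.
Qed.

Lemma quasi_kernel_state10 : quasi_kernel state10 = quasi_ext 0.
Proof.
rewrite (quasi_kernel_eq delta_adot delta_neq0 state10E); apply/seteqP.
split=> _ [f <- E]; exists f => //; move: E.
  by move/eqP; rewrite mulf_eq0 oppr_eq0 (negbTE (neq0Ci _)) mul0r addr0 => /eqP.
by rewrite mul0r addr0 => ->; rewrite mulr0.
Qed.

Lemma quasi_kernel_re_state10 : quasi_kernel (re_op state10) = A.
Proof.
rewrite (quasi_kernel_eq delta_adot delta_neq0 re_state10E); apply/seteqP.
split=> [_ [f <-]|[x y] Axy].
  move/eqP; rewrite mulf_eq0 oppr_eq0 mulf_eq0 invr_eq0 pnatr_eq0.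
  by rewrite (negbTE (neq0Ci _)) /= => /eqP/sa_ext_graphP.
have [f fE] := sa_ext_lift Axy; rewrite -fE in Axy *; exists f => //.
by have /sa_ext_graphP -> := Axy; rewrite mulr0.
Qed.

Lemma adj_quasi_ext0 : adj (quasi_ext 0) `<=` quasi_kernel (adjoint state10).
Proof.
rewrite (quasi_kernel_eq delta_adot delta_neq0 adjoint_state10E) => -[x y] adjT.
have [_ adotT _ _] := quasi_ext0_quasi_self_adjoint.
have [f fE] : exists f, graph f = (x, y) by apply: star_lift => q /adotT/adjT.
rewrite -fE in adjT *; exists f => //.
have Tgp : quasi_ext 0 (graph gp) by apply/quasi_ext_graphP; rewrite minus_gp mul0r addr0.
have := green gp f; rewrite [ip (star gp) _](adjT _ Tgp) subrr plus_gp minus_gp.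
rewrite mul0r subr0 mul1r => /esym/(congr1 Num.conj).
rewrite rmorphM /= conjCi conjCK rmorph0.
by [].
Qed.

Lemma channel10_linear : linear channel10.
Proof. by move=> a c d; rewrite /channel10 scalerDl (scalerA a c). Qed.

Lemma conj_sqrt2 : (sqrtC 2)^* = sqrtC 2 :> C.
Proof. by apply/conj_Creal/ger0_real; rewrite sqrtC_ge0 ler0n. Qed.

Lemma channel10_adjoint f :
  channel_adjoint channel10 f = (sqrtC 2)^-1 * (plus f - minus f).
Proof.
rewrite channel_adjointE; last exact: channel10_linear.
rewrite /channel10 !functionalZ mul1r deltaE rmorphM fmorphV rmorphB /= !conjCK.
by rewrite conj_sqrt2.
Qed.

Lemma bounded_channel10 : bounded_channel channel10.
Proof.
split; first exact: channel10_linear.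
have [c dc] := functional_bounded ((sqrtC 2)^-1 *: delta).
exists c => w f; rewrite functionalZ normrM [c * _]mulrC -mulrA ler_wpM2l //.
Qed.

Definition theta10 := Lsystem (quasi_ext 0) state10 channel10.

Lemma theta10_lsystem : is_lsystem theta10.
Proof.
have [Tl adotT Tadot nsym] := quasi_ext0_quasi_self_adjoint.
have rho : resolvent_set (quasi_ext 0) !=set0.
  by exists (- 'i); apply: quasi_ext_resolvent; exact: quasi_ext0_dissipative.
have adotS : adot `<=` adj (quasi_ext 0).
  move=> [x y] xy q [f <- _]; have [h hE] := adot_sub_star xy.
  rewrite -hE in xy *; have := adot_adjoint f xy.
  by move=> /(congr1 Num.conj); rewrite !ip_conj => ->.
split; first by [].
- by split=> //; exact: quasi_ext0_dissipative.
- split; first by split.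
  + exact: bounded_state10.
  + by rewrite /= quasi_kernel_state10; split.
  + by split=> //; exact: adj_quasi_ext0.
  + rewrite /t_self_adjoint /= quasi_kernel_re_state10; split => //.
    split=> //; first exact: bounded_re_state10.
      by rewrite quasi_kernel_re_state10.
    exact: adjoint_re_state10.
- exact: bounded_channel10.
apply/funext => f /=; rewrite im_state10E channel10_adjoint /channel10 scalerA.
congr (_ *: _); rewrite mulrAC -invfM -expr2 sqrtCK.
by [].
Qed.

Lemma weyl_deficiency g z : deficiency_space adot 'i g -> `|g| = 1 -> 'Im z != 0 ->
  exists r : Hplus adot, [/\ plus r + minus r = 0, star r = val gp + z *: val r
    & weyl_titchmarsh A g z = z + 2 * (1 + z ^+ 2) * ip (val r) (val gp)].
Proof.
move=> gdef g1 z0; have [_ _ adjA] := A_sa.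
have [c gE] := one_dimensional_span adot_def.1 gp_def gp_neq0 gdef.
have cc : c * c^* = 2.
  have : ip g g = 1 by rewrite ip_norm g1 expr1n.
  rewrite {1 2}gE !ipE ip_gp => E.
  by rewrite -[RHS]mulr1 -[X in _ = _ * X]E; field.
have [r [Ar rE]] := sa_ext_solvable (val gp) z0.
have pmr : plus r + minus r = 0 by apply/sa_ext_graphP.
exists r; split=> //; rewrite weyl_titchmarshE // ip_norm g1 expr1n mulr1.
have Af := resolventP g adjA z0; have [f fE] := sa_ext_lift Af.
have fx : val f = resolvent A z g := congr1 fst fE.
have sf : star f = g + z *: val f by have := congr1 snd fE; rewrite -fx.
have /eqP : f - c *: r = 0.
  apply: sa_ext_eigen z0 _ _.
    rewrite starB starZ sf rE val_plusB val_plusZ gE scalerDr opprD addrACA subrr add0r.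
    by rewrite scalerBr !scalerA mulrC.
  have pmf : plus f + minus f = 0 by apply/sa_ext_graphP; rewrite fE.
  rewrite !ip_plus_lin -[RHS](subrr (plus f + minus f)) {2}pmf -(mulr0 c) -pmr; ring.
rewrite subr_eq0 => /eqP fr; rewrite -fx fr val_plusZ gE !ipE.
by rewrite -cc; ring.
Qed.

Lemma theta10_impedance g : deficiency_space adot 'i g -> `|g| = 1 ->
  is_impedance theta10 (weyl_titchmarsh A g).
Proof.
move=> gdef g1; split; last by move=> z z0; exact: derivable_weyl_titchmarsh.
move=> z z0 _ /=.
have BE f : re_op state10 f - z *: emb (val f) =
    emb (star f - z *: val f) + (- ('i / 2) * (plus f + minus f)) *: delta.
  apply: functional_eq => h; rewrite functionalB re_state10E !emb_addZ functionalZ.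
  by rewrite embE ipBl ipZl; ring.
split=> [f1 f2|c].
  rewrite !BE => /eqP; rewrite -subr_eq -addrA -scalerBl => /eqP/emb_separated[|sE].
    by move=> f fA; rewrite functionalZ delta_adot // mulr0.
  move=> /eqP; rewrite scaler_eq0 (negbTE delta_neq0) orbF -mulrBr mulf_eq0.
  rewrite oppr_eq0 mulf_eq0 invr_eq0 pnatr_eq0 (negbTE (neq0Ci _)) /= => /eqP lE.
  apply/eqP; rewrite -subr_eq0; apply/eqP; apply: sa_ext_eigen z0 _ _.
    rewrite starB val_plusB scalerBr -[star f1](subrK (z *: val f1)) sE.
    by rewrite addrAC [star f2 - _]addrC addrK addrC.
  by rewrite !ip_plusB -lE; ring.
have [r [pmr rE wE]] := weyl_deficiency gdef g1 z0.
pose fz := gp + (z - 'i) *: r.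
have sfz : star fz = z *: val fz.
  rewrite /fz starD starZ rE star_gp val_plusD val_plusZ scalerDr addrA -scalerDl.
  by rewrite [_ + (z - _)]addrC subrK scalerDr !scalerA mulrC.
have mr : minus r = - plus r by apply/eqP; rewrite -addr_eq0 addrC pmr.
have pfz : plus fz = 1 + (z - 'i) * plus r by rewrite !ip_plus_lin plus_gp.
have mfz : minus fz = - (z - 'i) * plus r.
  by rewrite !ip_plus_lin minus_gp mr; ring.
have pr : plus r = (1 - 'i * z) * ip (val r) (val gp) - 'i / 2.
  by rewrite plusE rE ipDl ipZl ip_gp; ring.
have s2 : (sqrtC 2)^-1 * (sqrtC 2)^-1 = 2^-1 :> C by rewrite -invfM -expr2 sqrtCK.
exists ((2 * 'i * c * (sqrtC 2)^-1) *: fz).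
  rewrite BE starZ sfz val_plusZ [z *: (_ *: _)]scalerA scalerA [z * _]mulrC subrr.
  rewrite /channel10 scalerA; have -> : emb 0 = 0 :> Hminus adot.
    by apply: functional_eq => h; rewrite embE ip0l.
  rewrite add0r; congr (_ *: _); rewrite !ip_plusZ -mulrDr pfz mfz.
  by move: (sqrtC 2)^-1 => s; field: ii.
rewrite channel10_adjoint !ip_plusZ pfz mfz wE pr.
move: (sqrtC 2)^-1 s2 => s s2; set P := _ - 'i / 2.
have -> : s * (2 * 'i * c * s * (1 + (z - 'i) * P) -
    2 * 'i * c * s * (- (z - 'i) * P)) =
    s * s * (2 * 'i * c * (1 + 2 * (z - 'i) * P)) by ring.
by rewrite s2 /P; field: ii.
Qed.

Lemma quasi_ext0_is_kappa : is_kappa (val gp) (val gm) (quasi_ext 0) 0.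
Proof.
have key k : dom (quasi_ext 0) (val gp - k *: val gm) <-> k = 0.
  split=> [[y [f fE]]|->].
    rewrite mul0r addr0; have -> : f = gp - k *: gm.
      by apply: val_inj; rewrite val_plusB val_plusZ; have := congr1 fst fE.
    rewrite !ip_plus_lin minus_gp minus_gm => /eqP.
    by rewrite mulr1 sub0r oppr_eq0 => /eqP.
  exists (star gp); rewrite scale0r subr0; apply/quasi_ext_graphP.
  by rewrite minus_gp mul0r addr0.
split; first by rewrite normr0 ltr01; split=> //; exact/key.
by move=> k [_ /key].
Qed.

Lemma sa_ext_is_U : is_U (val gp) (val gm) A (-1).
Proof.
split; first by rewrite normrN1 scaleN1r.
move=> U [_ [y AU]]; have [f fE] := sa_ext_lift AU.
have : plus f + minus f = 0 by apply/sa_ext_graphP; rewrite fE.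
have -> : f = gp + U *: gm.
  by apply: val_inj; rewrite val_plusD val_plusZ; have := congr1 fst fE.
rewrite !ip_plus_lin plus_gp minus_gp plus_gm minus_gm => /eqP.
by rewrite mulr0 addr0 add0r mulr1 addr_eq0 => /eqP ->; rewrite opprK.
Qed.

Lemma quasi_ext_minus0 kappa :
  (forall f, quasi_ext kappa (graph f) -> minus f = 0) -> kappa = 0.
Proof.
move=> km; have : minus (gp - kappa *: gm) = 0.
  apply/km/quasi_ext_graphP; rewrite !ip_plus_lin plus_gp minus_gp plus_gm minus_gm.
  by ring.
rewrite !ip_plus_lin minus_gp minus_gm mulr1 sub0r => /eqP.
by rewrite oppr_eq0 => /eqP.
Qed.

Lemma state10_main_op (Theta : lsystem adot) :
  is_lsystem Theta -> state_op Theta = state10 -> main_op Theta = quasi_ext 0.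
Proof.
move=> [_ [qsa diss _] [_ _ [TA _] _ _] _ _] SE.
have [k TE] := dissipative_qsa_ext qsa diss.
rewrite TE; congr quasi_ext; apply: quasi_ext_minus0 => f; rewrite -TE => /TA.
rewrite SE quasi_kernel_state10 => /quasi_ext_graphP.
by rewrite mul0r addr0.
Qed.

End Theta10.

(** * L-systems with a given impedance *)

Section GivenImpedance.
Context (Theta : lsystem adot) (g : H) (V : C -> C).
Context (Theta_sys : is_lsystem Theta)
        (Theta_A : quasi_kernel (re_op (state_op Theta)) = A)
        (Theta_V : is_impedance Theta V)
        (V_Ni : V (- 'i) = - 'i).
Local Notation S := (state_op Theta).
Local Notation B := (re_op S).
Local Notation K := (channel_op Theta).
Local Notation chi := (K 1).
Local Notation u := (B gp - emb (star gp)).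

Let B_bounded : bounded_operator B.
Proof. by have [_ _ [_ _ _ _ [[]]]] := Theta_sys. Qed.

Let B_linear : linear B. Proof. by case: B_bounded. Qed.

Lemma bi_extension_sym f h : B f h = (B h f)^*.
Proof.
have [_ _ [_ _ _ _ [[_ _ Badj] _]] _ _] := Theta_sys.
by rewrite -{1}Badj adjointE.
Qed.

Lemma im_stateE f : im_op S f = (chi f)^* *: chi.
Proof.
have [_ _ _ [Klin _] ->] := Theta_sys.
by rewrite /= channel_adjointE // linear_channelE.
Qed.

Lemma state_decomposition f : S f = B f + ('i * (chi f)^*) *: chi.
Proof.
rewrite -scalerA -im_stateE; apply: functional_eq => h.
by rewrite /re_op /im_op !functionalE; field; rewrite neq0Ci.
Qed.

Lemma chi_adot f : adot (graph f) -> chi f = 0.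
Proof.
move=> fA; have [_ _ [_ _ [TS aT] [TsS aTs] _] _ _] := Theta_sys.
have Sf : S f = emb (star f) by have [f' /val_inj -> ->] := TS _ (aT _ fA).
have Ssf : adjoint S f = emb (star f) by have [f' /val_inj -> ->] := TsS _ (aTs _ fA).
have := im_stateE f; rewrite /im_op Sf Ssf subrr scaler0 => /(congr1 (fun w => w f)).
rewrite functional0 functionalZ mulrC -normCK => /esym/eqP.
by rewrite expf_eq0 normr_eq0 => /eqP.
Qed.

Lemma re_state_A f : plus f + minus f = 0 -> B f = emb (star f).
Proof. by move=> /sa_ext_graphP; rewrite -Theta_A => -[f' /val_inj -> ->]. Qed.

Lemma re_stateE f : B f = emb (star f) + (plus f + minus f) *: u.
Proof.
set l := plus f + minus f; have := re_state_A (f := f - l *: gp).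
rewrite !ip_plus_lin plus_gp minus_gp => /(_ _) E.
have {}E : B (f - l *: gp) = emb (star (f - l *: gp)) by apply: E; rewrite /l; ring.
rewrite -{1}[f](subrK (l *: gp)) addrC B_linear E; apply: functional_eq => h.
by rewrite !functionalE !embE starB starZ !ipE; ring.
Qed.

Lemma u_adot f : adot (graph f) -> u f = 0.
Proof.
move=> fA; have /adot_graphP[pf mf] := fA.
have /(congr1 Num.conj) := adot_adjoint gp fA; rewrite !ip_conj => E.
rewrite functionalB bi_extension_sym re_state_A ?pf ?mf ?addr0 //.
by rewrite !embE ip_conj E subrr.
Qed.

Lemma uE f : u f = (plus f)^* * u gp + (minus f)^* * u gm.
Proof.
have /u_adot/eqP := adot_residual f.
rewrite 2!functional_antilinearB !functional_antilinearZ subr_eq0 subr_eq => /eqP ->.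
by rewrite addrC.
Qed.

Lemma u_sub : u gp - u gm = - 'i.
Proof.
rewrite -functional_antilinearB functionalB bi_extension_sym re_state_A; last first.
  by rewrite !ip_plus_lin plus_gp minus_gp plus_gm minus_gm; ring.
rewrite !embE starB star_gp star_gm val_plusB !ipE ip_gp.
rewrite rmorphB !rmorphM rmorphN /= fmorphV rmorph_nat conjCi ip_conj.
by field.
Qed.

Lemma u_gp_conj : u gp - (u gp)^* = - 'i.
Proof.
rewrite functionalB !embE star_gp ipZl ip_gp; have := bi_extension_sym gp gp.
move: (B gp gp) => b bE; rewrite rmorphB rmorphM fmorphV rmorph_nat /= -bE conjCi.
by field.
Qed.

(* Evaluating the impedance at [- 'i], where the solution of
   [(Re S + 'i) f = chi] is a multiple of [gm], determines [chi]. *)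
Lemma chi_parallel_u : exists d,
  [/\ chi = d *: u, d * d^* = 2, u gm = 'i / 2 & u gp = - 'i / 2].
Proof.
have [_ [qsa diss _] _ _ _] := Theta_sys.
have [k TE] := dissipative_qsa_ext qsa diss.
have rho : resolvent_set (main_op Theta) (- 'i).
  by rewrite TE; apply: quasi_ext_resolvent; rewrite -TE.
have Ni0 : 'Im (- 'i) != 0 :> C by rewrite raddfN /= Im_i oppr_eq0 oner_eq0.
have [_ /(_ 1)[f fE Vf]] := Theta_V.1 _ Ni0 rho.
have w0 h : adot (graph h) -> ((plus f + minus f) *: u - chi) h = 0.
  by move=> hA; rewrite functionalB functionalZ u_adot // chi_adot // mulr0 subrr.
have := emb_separated (k := star f + 'i *: val f) (k' := 0) w0.
have -> : emb (star f + 'i *: val f) + ((plus f + minus f) *: u - chi) =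
    emb 0 :> Hminus adot.
  rewrite -fE (re_stateE f); move: u => w; apply: functional_eq => h.
  by rewrite !functionalE !embE !ipE ip0l; ring.
move=> /(_ erefl)[/eqP]; rewrite addr_eq0 => /eqP; rewrite -scaleNr => /eigen_Ni[d dE].
rewrite dE !ip_plusZ plus_gm minus_gm mulr0 add0r mulr1 => /eqP.
rewrite subr_eq0 => /eqP/esym chiE; exists d.
have bE : d * d^* * u gm = 'i.
  have [_ _ _ [Klin _] _] := Theta_sys.
  have := Vf; rewrite V_Ni mulr1 channel_adjointE // chiE dE.
  rewrite functionalZ functional_antilinearZ => /(congr1 Num.conj).
  by rewrite conjCK rmorphN /= conjCi opprK mulrA => <-.
have Nconj : (d * d^*)^* = d * d^* by rewrite rmorphM /= conjCK mulrC.
have aE : u gp = u gm - 'i by rewrite -[LHS](subrK (u gm)) u_sub addrC.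
have bb : u gm - (u gm)^* = 'i.
  have sub_conj (b : C) : b - 'i - (b - 'i)^* = - 'i -> b - b^* = 'i.
    rewrite rmorphB /= conjCi => E.
    have -> : b - b^* = b - 'i - (b^* - - 'i) + 2 * 'i by ring.
    by rewrite E; ring.
  by apply: sub_conj; rewrite -aE u_gp_conj.
have N2 : d * d^* = 2.
  apply: (mulIf (neq0Ci C)); rewrite -{1}bb mulrBr bE.
  have := congr1 Num.conj bE; rewrite rmorphM /= Nconj conjCi => ->.
  by ring.
have ub : u gm = 'i / 2 by rewrite -bE N2; field.
by split=> //; rewrite aE ub; field.
Qed.

Lemma given_impedance_main_op : main_op Theta = quasi_ext 0.
Proof.
have [_ [qsa diss _] [_ _ [TS _] _ _] _ _] := Theta_sys.
have [k TE] := dissipative_qsa_ext qsa diss.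
have [d [chiE d2 ub ua]] := chi_parallel_u.
rewrite TE; congr quasi_ext; apply: quasi_ext_minus0 => f.
rewrite -TE => /TS[f' /val_inj ->].
rewrite state_decomposition (re_stateE f) => /(congr1 (fun w => w gm)).
have uf := uE f; rewrite ua ub in uf.
rewrite chiE !functionalD !(functionalZ _ _ gm) (functionalZ d u f) uf ub.
rewrite -addrA -[RHS]addr0 => /addrI.
have -> : (d * ((plus f)^* * (- 'i / 2) + (minus f)^* * ('i / 2)))^* =
    d^* * ('i / 2 * (plus f - minus f)).
  rewrite rmorphM rmorphD !rmorphM /= !conjCK fmorphV rmorphN rmorph_nat /= conjCi.
  by ring.
move=> E; have : 'i * minus f = 0.
  rewrite -E; transitivity ((plus f + minus f) * ('i / 2) +
    'i * (d * d^*) * ('i / 2) * ('i / 2 * (plus f - minus f))); last by ring.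
  by rewrite d2; field: ii.
by move=> /eqP; rewrite mulf_eq0 (negbTE (neq0Ci _)) => /eqP.
Qed.

End GivenImpedance.

End SelfAdjointExtension.

End Extensions.

Theorem theorem5 (R : realType) (H : hilbertType R) (adot A : set (H * H))
    (gp gm : Hplus adot) (phi psi : Hminus adot) (g : H)
    (adot_sym : closed_symmetric adot)
    (adot_def : deficiency_indices_11 adot)
    (gp_def : deficiency_space adot 'i (val gp))
    (gm_def : deficiency_space adot (- 'i) (val gm))
    (gp_norm : norm_plus gp = 1) (gm_norm : norm_plus gm = 1)
    (phi_def : riesz_berezansky phi = gp)
    (psi_def : riesz_berezansky psi = gm)
    (A_sa : self_adjoint A) (adot_A : adot `<=` A)
    (A_dom : dom A (val gp - val gm))
    (g_def : deficiency_space adot 'i g) (g_norm : `|g| = 1) :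
  let A10 : Hplus adot -> Hminus adot :=
    fun f => adot_star f - 'i *: rank_one psi (phi - psi) f in
  let chi10 : Hminus adot := (sqrtC 2)^-1 *: (phi - psi) in
  let K10 : R[i] -> Hminus adot := fun c => c *: chi10 in
  let V_is_M (Theta : lsystem adot) :=
    exists2 V, is_impedance Theta V &
      forall z, 'Im z != 0 -> V z = weyl_titchmarsh A g z in
  (exists Theta10 : lsystem adot,
     [/\ unique (fun Theta => [/\ is_lsystem Theta, state_op Theta = A10,
                                  channel_op Theta = K10 & V_is_M Theta])
           Theta10,
         quasi_kernel (re_op A10) = A,
         is_kappa (val gp) (val gm) (main_op Theta10) 0
       & is_U (val gp) (val gm) (quasi_kernel (re_op A10)) (-1)]) /\
  (forall Theta : lsystem adot,
     is_lsystem Theta -> quasi_kernel (re_op (state_op Theta)) = A ->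
     V_is_M Theta ->
     is_kappa (val gp) (val gm) (main_op Theta) 0 /\
     is_U (val gp) (val gm) (quasi_kernel (re_op (state_op Theta))) (-1)).
Proof.
move=> A10 chi10 K10 V_is_M; have [_ adot_dense _ _] := adot_sym.
have gp0 : gp != 0.
  apply: contra (gp_neq0 adot_dense gp_def gp_norm) => /eqP ->.
  by rewrite val_plus0.
have gm0 : gm != 0.
  apply: contra (gm_neq0 adot_dense gm_def gm_norm) => /eqP ->.
  by rewrite val_plus0.
have phiE := riesz_berezanskyP phi_def gp0.
have psiE := riesz_berezanskyP psi_def gm0.
have kappaP := quasi_ext0_is_kappa adot_dense gp_def gm_def gm_norm.
have UP := sa_ext_is_U adot_dense adot_sym adot_def gp_def gm_def gp_norm gm_norm
  A_sa adot_A A_dom.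
have AE : quasi_kernel (re_op A10) = A :=
  quasi_kernel_re_state10 adot_dense adot_sym adot_def gp_def gm_def gp_norm gm_norm
    A_sa adot_A A_dom phiE psiE.
split=> [|Theta Theta_sys Theta_A [V VTheta VM]].
  exists (theta10 gp gm phi psi); split => //; last by rewrite AE.
  split.
    split=> //.
      exact: (theta10_lsystem adot_dense adot_sym adot_def gp_def gm_def gp_norm
        gm_norm A_sa adot_A A_dom phiE psiE).
    exists (weyl_titchmarsh A g) => //.
    exact: (theta10_impedance adot_dense adot_sym adot_def gp_def gm_def gp_norm
      gm_norm A_sa adot_A A_dom phiE psiE g_def g_norm).
  move=> Theta' [sys' S' K' _].
  have T' := state10_main_op adot_dense adot_sym adot_def gp_def gm_def gp_norm
    gm_norm phiE psiE sys' S'.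
  by case: Theta' {sys'} S' K' T' => T S K /= -> -> ->.
rewrite Theta_A; split=> //.
have Ni0 : 'Im (- 'i) != 0 :> R[i] by rewrite raddfN /= Im_i oppr_eq0 oner_eq0.
have V_Ni : V (- 'i) = - 'i.
  rewrite VM // weyl_titchmarshE // ip_norm g_norm expr1n mulr1 sqrrN sqrCi.
  by rewrite addrN mul0r addr0.
rewrite (given_impedance_main_op adot_dense adot_sym adot_def gp_def gm_def gp_norm
  gm_norm A_sa adot_A A_dom Theta_sys Theta_A VTheta V_Ni).
exact: kappaP.
Qed.
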